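(* Let $1\le m\le n$, $0\le p\le m$, $0\le q\le n$, and set $d:=p+q$, $k:=m+n-d-1$, $\sigma:=q(m-p)+n(d-m)+d+n-q-1$. Then $$\operatorname{Sylv}^{p,q}(A,B;x)=\begin{cases} (-1)^{p(m-d)}\binom{d}{p}\,\mathrm{Sres}_d(f,g) & \text{for } 0\le d<m \text{ or } m=d<n,\\[1mm] 0 & \text{for } m<d<n-1,\\[1mm] (-1)^{(m+q)(p+1)}\binom{m}{p}\, f & \text{for } m<d=n-1,\\[1mm] (-1)^{\sigma}\Big(\binom{k}{m-p}F_k\, f-\binom{k}{n-q}G_k\, g\Big) & \text{for } n\le d\le m+n-1,\\[1mm] \mathrm{Res}(f,g)\, f g & \text{for } d=m+n. \end{cases}$$
   Context: $A=(\alpha_1,\dots,\alpha_m)$ and $B=(\beta_1,\dots,\beta_n)$ are finite lists of distinct indeterminates over $\mathbb{Q}$ (all $m+n$ of them independent), with $|A|=m\ge 1$, $|B|=n\ge 1$, and $x$ is a further indeterminate. For finite sets $Y,Z$ and an element $y$, put $R(Y,Z):=\prod_{y\in Y,\,z\in Z}(y-z)$ and $R(y,Z):=\prod_{z\in Z}(y-z)$ (empty products equal $1$). Sylvester's double sum is, for $0\le p\le m$, $0\le q\le n$, $$\operatorname{Sylv}^{p,q}(A,B;x):=\sum_{\substack{A'\subset A,\ B'\subset B\\ |A'|=p,\ |B'|=q}}R(x,A')\,R(x,B')\,\frac{R(A',B')\,R(A\setminus A',B\setminus B')}{R(A',A\setminus A')\,R(B',B\setminus B')}.$$ Put $f:=\prod_{\alpha\in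 A}(x-\alpha)=x^m+a_{m-1}x^{m-1}+\cdots+a_0$ and $g:=\prod_{\beta\in B}(x-\beta)=x^n+b_{n-1}x^{n-1}+\cdots+b_0$, with $a_m=b_n=1$ and $a_\ell=0$ for $\ell<0$ or $\ell>m$, $b_\ell=0$ for $\ell<0$ or $\ell>n$. $\mathrm{Res}(f,g)=\prod_{\alpha\in A,\beta\in B}(\alpha-\beta)$ is the resultant. Subresultants: for $0\le j\le m<n$ or $0\le j<m=n$, $\mathrm{Sres}_j(f,g)$ is the determinant of the square matrix of size $m+n-2j$ whose row $i$ for $1\le i\le n-j$ has entries $a_{m+i-c}$ in columns $1\le c\le m+n-2j-1$ and $x^{n-j-i}f(x)$ in the last column, and whose row $n-j+i$ for $1\le i\le m-j$ has entries $b_{n+i-c}$ in columns $1\le c\le m+n-2j-1$ and $x^{m-j-i}g(x)$ in the last column. (In particular $\mathrm{Sres}_m(f,g)=f$ if $m<n$.) $F_j$ is the determinant of the same matrix with its last column replaced by $(x^{n-j-1},\dots,x^0,0,\dots,0)^t$ ($n-j$ powers of $x$ followed by $m-j$ zeros), and $G_j$ is the determinant with the last column replaced by $(0,\dots,0,x^{m-j-1},\dots,x^0)^t$ ($n-j$ zeros followed by $m-j$ powers of $x$). Thus $\mathrm{Sres}_j(f,g)=F_j f+G_j g$. Binomial coefficients $\binom{a}{b}$ are $0$ when $b<0$ or $b>a$. *)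

(* Defs.v *)
From HB Require Import structures.
From mathcomp Require Import all_boot all_order all_algebra.
From mathcomp Require Import mpoly.

Set Implicit Arguments.
Unset Strict Implicit.
Unset Printing Implicit Defensive.

Import GRing.Theory.
Local Open Scope ring_scope.

(** R(Y, Z), for the sets {y i | i in Y} and {z j | j in Z} *)
Definition Rprod (S : comNzRingType) (I J : finType) (y : I -> S) (z : J -> S)
    (Y : {set I}) (Z : {set J}) : S :=
  \prod_(i in Y) \prod_(j in Z) (y i - z j).

(** R(x, Z), where x is the polynomial variable *)
Definition RprodX (S : comNzRingType) (J : finType) (z : J -> S) (Z : {set J}) :
    {poly S} :=
  \prod_(j in Z) ('X - (z j)%:P).

Section Sylv.
Variables (K : fieldType) (m n : nat) (a : 'I_m -> K) (b : 'I_n -> K).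

(** Subsets of A and B are represented by sets of indices, so this is
    Sylvester's double sum only when [a] and [b] are injective. *)
Definition Sylv (p q : nat) : {poly K} :=
  \sum_(A' : {set 'I_m} | #|A'| == p) \sum_(B' : {set 'I_n} | #|B'| == q)
    ((Rprod a b A' B' * Rprod a b (~: A') (~: B')) /
     (Rprod a a A' (~: A') * Rprod b b B' (~: B')))
    *: (RprodX a A' * RprodX b B').

End Sylv.

Section Subresultant.
Variables (S : comNzRingType).

(** The coefficient of index l, extended by 0 to all l : int *)
Definition coefz (f : {poly S}) (l : int) : S :=
  if l is Posz l' then f`_l' else 0.

(** The matrix of size m + n - 2j = (n - j) + (m - j), for f of degree m and g
    of degree n, whose last column is u on top of v. Rows and columns are
    numbered from 0, which leaves the index differences i - c unchanged. *)
Definition sres_mx (m n j : nat) (f g : {poly S})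
    (u : 'I_(n - j) -> {poly S}) (v : 'I_(m - j) -> {poly S}) :
    'M[{poly S}]_((n - j) + (m - j)) :=
  \matrix_(r, c)
    match split r with
    | inl i => if c.+1 == ((n - j) + (m - j))%N then u i
               else (coefz f (m%:Z + i%:Z - c%:Z))%:P
    | inr i => if c.+1 == ((n - j) + (m - j))%N then v i
               else (coefz g (n%:Z + i%:Z - c%:Z))%:P
    end.

Definition Sres (m n j : nat) (f g : {poly S}) : {poly S} :=
  \det (@sres_mx m n j f g (fun i => 'X^(n - j - i.+1) * f)
                           (fun i => 'X^(m - j - i.+1) * g)).

Definition SresF (m n j : nat) (f g : {poly S}) : {poly S} :=
  \det (@sres_mx m n j f g (fun i => 'X^(n - j - i.+1)) (fun=> 0)).

Definition SresG (m n j : nat) (f g : {poly S}) : {poly S} :=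
  \det (@sres_mx m n j f g (fun=> 0) (fun i => 'X^(m - j - i.+1))).

End Subresultant.

(** The field Q(alpha_1, ..., alpha_m, beta_1, ..., beta_n) *)
Definition ratfun (m n : nat) : fieldType := {fraction {mpoly rat[m + n]}}.

Definition alpha (m n : nat) (i : 'I_m) : ratfun m n :=
  tofrac ('X_(lshift n i) : {mpoly rat[m + n]}).

Definition beta (m n : nat) (j : 'I_n) : ratfun m n :=
  tofrac ('X_(rshift m j) : {mpoly rat[m + n]}).

(* Main.v *)
Require Import Defs.
From HB Require Import structures.
From mathcomp Require Import all_boot all_order all_algebra.
From mathcomp Require Import mpoly.
From mathcomp Require Import fingroup perm zify ring.

Set Implicit Arguments.
Unset Strict Implicit.
Unset Printing Implicit Defensive.

Import GRing.Theory.
Local Open Scope ring_scope.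

(** Write V(y_1, ..., y_N) for the determinant of the powers of the y_j in degrees
    N - 1, ..., 0, that is, the product of the y_i - y_j over i < j. Clearing the
    denominators of the double sum turns each term, up to a sign, into
    V(x, A', B') * V(A \ A', B \ B') / (V(A) * V(B)), a product of a determinant of
    size d + 1 and one of size k + 1, with d = p + q and k = m + n - d - 1. Such a sum
    over subsets is a Laplace expansion. Let D(t) be the determinant with columns
    indexed by x, A, B whose first d + 1 rows hold the values of the powers in degrees
    d, ..., 0, with the columns of A multiplied by t, and whose last k + 1 rows hold
    the powers in degrees k, ..., 0 on A and B and 0 on x. Then the coefficient of t^p
    in D(t) is (-1)^(q (m - p)) V(A) V(B) Sylv^{p,q} ([coef_gen_det]), so that all
    double sums with the same d are read off from a single determinant, which row
    operations evaluate:

    - for d <= k, subtracting t times the lower rows from the upper ones shows that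
      D(t) is (1 - t)^d times a determinant free of t ([dbl_det_low]);
    - for d > m and k > m, the polynomial (X - x) f is a combination of the powers in
      either half and vanishes at x and on A, so that the rows are dependent and
      D(t) = 0 ([dbl_det_eq0]);
    - for d = n - 1 and k = m, this polynomial is too large for the lower half but f is
      not, and D(t) is a constant times (1 - t)^m f ([dbl_det_middle]);
    - for k < m, taking factors t and t - 1 out of rows and columns gives
      D(t) = t^(m-k-1) (t - 1)^k (t U - U'), with U and U' free of t and exchanged, up
      to sign, by the exchange of A and B ([dbl_det_high]).

    The binomial coefficients are those of the powers of 1 - t and t - 1. It remains to
    recognize the determinants free of t. Replacing high powers by multiples of f makes
    the columns of A split off as V(A); what is left is a determinant of f(beta) beta^i
    and beta^i, which is V(B) times a subresultant determinant, because evaluation at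
    the roots of g is reduction modulo g ([xdet_sylv_rows_mod], [xdet_sresF],
    [xdet_Sres]). *)

(** * Determinants of blocks with matching sizes *)

Section RectangularDet.
Variable R : comNzRingType.

(** The two sizes always agree, but often as different expressions, such as
    N + m and l + d; [conform_mx] avoids having a cast in every statement. *)
Definition xdet m n (A : 'M[R]_(m, n)) : R := \det (conform_mx (0 : 'M_m) A).

Lemma xdetE n (A : 'M[R]_n) : xdet A = \det A.
Proof. by rewrite /xdet conform_mx_id. Qed.

Lemma xdet1 n : xdet (1%:M : 'M[R]_n) = 1.
Proof. by rewrite xdetE det1. Qed.

Lemma xdet_cast m n m' n' (e : (m = m') * (n = n')) (A : 'M[R]_(m, n)) :
  xdet (castmx e A) = xdet A.
Proof. by case: e => e1 e2; subst m' n'; rewrite castmx_id. Qed.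

Lemma xdet_tr m n (A : 'M[R]_(m, n)) : m = n -> xdet A^T = xdet A.
Proof. by move=> e; subst n; rewrite !xdetE det_tr. Qed.

Lemma xdet_mul m n r (A : 'M[R]_(m, n)) (B : 'M_(n, r)) :
  m = n -> n = r -> xdet (A *m B) = xdet A * xdet B.
Proof. by move=> e1 e2; subst n r; rewrite !xdetE det_mulmx. Qed.

Lemma xdet_ublock m1 m2 n1 n2 (A : 'M[R]_(m1, n1)) B (D : 'M_(m2, n2)) :
  m1 = n1 -> m2 = n2 ->
  xdet (col_mx (row_mx A B) (row_mx 0 D)) = xdet A * xdet D.
Proof. by move=> e1 e2; subst n1 n2; rewrite !xdetE -(det_ublock _ B). Qed.

Lemma xdet_lblock m1 m2 n1 n2 (A : 'M[R]_(m1, n1)) B (D : 'M_(m2, n2)) :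
  m1 = n1 -> m2 = n2 ->
  xdet (col_mx (row_mx A 0) (row_mx B D)) = xdet A * xdet D.
Proof. by move=> e1 e2; subst n1 n2; rewrite !xdetE -(det_lblock _ B). Qed.

(** The lemmas named after [row] and [col] operate on the blocks of a
    [row_mx] and of a [col_mx] respectively; l, r tell which block changes. *)
Lemma xdet_row_mulr m n1 n2 r (X : 'M[R]_(m, n1)) (Y : 'M_(m, n2))
    (C : 'M_(n2, r)) :
  m = (n1 + n2)%N -> n2 = r ->
  xdet (row_mx X (Y *m C)) = xdet (row_mx X Y) * xdet C.
Proof.
move=> e1 e2; subst r m; have -> : row_mx X (Y *m C) =
  row_mx X Y *m col_mx (row_mx 1%:M 0) (row_mx 0 C).
  by rewrite mul_row_col !mul_mx_row !mulmx1 !mulmx0 add_row_mx addr0 add0r.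
by rewrite xdet_mul // xdet_ublock // xdet1 mul1r.
Qed.

Lemma xdet_row_mull m n1 n2 r (X : 'M[R]_(m, n1)) (Y : 'M_(m, n2))
    (C : 'M_(n1, r)) :
  m = (n1 + n2)%N -> n1 = r ->
  xdet (row_mx (X *m C) Y) = xdet (row_mx X Y) * xdet C.
Proof.
move=> e1 e2; subst r m; have -> : row_mx (X *m C) Y =
  row_mx X Y *m col_mx (row_mx C 0) (row_mx 0 1%:M).
  by rewrite mul_row_col !mul_mx_row !mulmx1 !mulmx0 add_row_mx addr0 add0r.
by rewrite xdet_mul // xdet_ublock // xdet1 mulr1.
Qed.

Lemma xdet_row_addr m n1 n2 (X : 'M[R]_(m, n1)) (Y : 'M_(m, n2)) C :
  m = (n1 + n2)%N -> xdet (row_mx X (Y + X *m C)) = xdet (row_mx X Y).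
Proof.
move=> e1; subst m; have -> : row_mx X (Y + X *m C) =
  row_mx X Y *m col_mx (row_mx 1%:M C) (row_mx 0 1%:M).
  by rewrite mul_row_col !mul_mx_row !mulmx1 !mulmx0 add_row_mx addr0 addrC.
by rewrite xdet_mul // xdet_ublock // !xdet1 !mulr1.
Qed.

Lemma xdet_row_addl m n1 n2 (X : 'M[R]_(m, n1)) (Y : 'M_(m, n2)) C :
  m = (n1 + n2)%N -> xdet (row_mx (X + Y *m C) Y) = xdet (row_mx X Y).
Proof.
move=> e1; subst m; have -> : row_mx (X + Y *m C) Y =
  row_mx X Y *m col_mx (row_mx 1%:M 0) (row_mx C 1%:M).
  by rewrite mul_row_col !mul_mx_row !mulmx1 !mulmx0 add_row_mx add0r.
by rewrite xdet_mul // xdet_lblock // !xdet1 !mulr1.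
Qed.

Lemma xdet_col_mulr m1 m2 n r (X : 'M[R]_(m1, n)) (Y : 'M_(m2, n))
    (C : 'M_(r, m2)) :
  n = (m1 + m2)%N -> m2 = r ->
  xdet (col_mx X (C *m Y)) = xdet C * xdet (col_mx X Y).
Proof.
move=> e1 e2; subst r; rewrite -!(@xdet_tr _ _ (col_mx _ _)) // !tr_col_mx.
by rewrite trmx_mul xdet_row_mulr // xdet_tr // mulrC.
Qed.

Lemma xdet_col_mull m1 m2 n r (X : 'M[R]_(m1, n)) (Y : 'M_(m2, n))
    (C : 'M_(r, m1)) :
  n = (m1 + m2)%N -> m1 = r ->
  xdet (col_mx (C *m X) Y) = xdet C * xdet (col_mx X Y).
Proof.
move=> e1 e2; subst r; rewrite -!(@xdet_tr _ _ (col_mx _ _)) // !tr_col_mx.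
by rewrite trmx_mul xdet_row_mull // xdet_tr // mulrC.
Qed.

Lemma xdet_col_addl m1 m2 n (X : 'M[R]_(m1, n)) (Y : 'M_(m2, n)) C :
  n = (m1 + m2)%N -> xdet (col_mx (X + C *m Y) Y) = xdet (col_mx X Y).
Proof.
move=> e1; rewrite -!(@xdet_tr _ _ (col_mx _ _)) // !tr_col_mx.
by rewrite linearD /= trmx_mul xdet_row_addl.
Qed.

Lemma xdet_rowA m n1 n2 n3 (X : 'M[R]_(m, n1)) (Y : 'M_(m, n2)) (Z : 'M_(m, n3)) :
  xdet (row_mx X (row_mx Y Z)) = xdet (row_mx (row_mx X Y) Z).
Proof. by rewrite row_mxA xdet_cast. Qed.

Lemma xdet_colA m1 m2 m3 n (X : 'M[R]_(m1, n)) (Y : 'M_(m2, n)) (Z : 'M_(m3, n)) :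
  xdet (col_mx X (col_mx Y Z)) = xdet (col_mx (col_mx X Y) Z).
Proof. by rewrite col_mxA xdet_cast. Qed.

End RectangularDet.

Lemma xdet_map (R S : comNzRingType) (phi : {rmorphism R -> S}) m n
    (A : 'M[R]_(m, n)) : m = n -> xdet (map_mx phi A) = phi (xdet A).
Proof. by move=> e; subst n; rewrite !xdetE det_map_mx. Qed.

(** * Vandermonde matrices in decreasing powers *)

(** Points come in families indexed by ordinals; this is the family reduced to x. *)
Notation pt x := (fun _ : 'I_1 => x).

Section Vandermonde.
Variable R : comNzRingType.
Implicit Types (f h : {poly R}).

(** The rows are the values of X^(N-1) f, ..., X f, f, in the order in which
    these multiples appear in the subresultant matrix. *)
Definition ev N f M (y : 'I_M -> R) : 'M[R]_(N, M) :=
  \matrix_(i, j) (f.[y j] * y j ^+ (N - i.+1)).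

Definition pw N M (y : 'I_M -> R) : 'M[R]_(N, M) := ev N 1 y.

Definition vander N (y : 'I_N -> R) : R := \det (pw N y).

(** Coefficients run from degree N - 1 down to degree 0, to match the rows of
    [pw N y]: multiplication by [pw N y] then evaluates polynomials at y. *)
Definition coef_mx N r (q : 'I_r -> {poly R}) : 'M[R]_(r, N) :=
  \matrix_(i, j) (q i)`_(N - j.+1).

Lemma coef_mx_pw N r (q : 'I_r -> {poly R}) M (y : 'I_M -> R) :
  (forall i, size (q i) <= N)%N ->
  coef_mx N q *m pw N y = \matrix_(i, j) (q i).[y j].
Proof.
move=> hq; apply/matrixP=> i j; rewrite !mxE (horner_coef_wide _ (hq i)).
rewrite [RHS](reindex_inj rev_ord_inj) /=.
by apply: eq_bigr => l _; rewrite !mxE hornerC mul1r.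
Qed.

Definition mulX N f (i : 'I_N) : {poly R} := f * 'X^(N - i.+1).
Arguments mulX N f i : clear implicits.

Lemma coef_mx_mulX N k f M (y : 'I_M -> R) : (size f + N <= k.+1)%N ->
  coef_mx k (mulX N f) *m pw k y = ev N f y.
Proof.
move=> hf; rewrite coef_mx_pw; first by apply/matrixP=> i j; rewrite !mxE hornerM hornerXn.
move=> i; rewrite (leq_trans (size_polyMleq _ _)) // size_polyXn.
by have := ltn_ord i; lia.
Qed.

Lemma pw_shift N m M (y : 'I_M -> R) :
  row_mx (0 : 'M_(m, N)) 1%:M *m pw (N + m) y = pw m y.
Proof.
apply/matrixP=> i j; rewrite -[pw (N + m) y]vsubmxK mul_row_col mul0mx add0r mul1mx.
by rewrite !mxE /=; congr (_ * _ ^+ _); lia.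
Qed.

(** For f of degree m, the passage from the powers of X in degrees below N + m
    to X^(N-1) f, ..., f, X^(m-1), ..., 1. *)
Definition basis_mx N m f : 'M[R]_(N + m, N + m) :=
  col_mx (coef_mx (N + m) (mulX N f)) (row_mx 0 1%:M).

Lemma basis_mxE N m f M (y : 'I_M -> R) : (size f <= m.+1)%N ->
  basis_mx N m f *m pw (N + m) y = col_mx (ev N f y) (pw m y).
Proof. by move=> hf; rewrite mul_col_mx coef_mx_mulX ?pw_shift //; lia. Qed.

(* upper unitriangular *)
(** The leading coefficients of X^(N-1) f, ..., f sit on the diagonal. *)
Lemma det_coef_mx_monic N m f (c := coef_mx (N + m) (mulX N f)) :
  f \is monic -> size f = m.+1 -> \det (lsubmx c) = 1.
Proof.
move=> fmon sf; rewrite -det_tr det_trig; last first.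
  apply/is_trig_mxP=> i j ij; rewrite !mxE coefMXn.
  case: ifP => // _; rewrite nth_default // sf /=.
  by have := ltn_ord j; lia.
rewrite big1 // => i _; rewrite !mxE coefMXn /= ifF; last by have := ltn_ord i; lia.
rewrite (_ : (_ - _ - _)%N = m); last by have := ltn_ord i; lia.
by have := monicP fmon; rewrite lead_coefE sf.
Qed.

Lemma det_basis_mx N m f : f \is monic -> size f = m.+1 -> \det (basis_mx N m f) = 1.
Proof.
move=> fmon sf; rewrite /basis_mx -[coef_mx _ _]hsubmxK -xdetE xdet_ublock //.
by rewrite xdet1 mulr1 xdetE det_coef_mx_monic.
Qed.

Lemma vander_mul f N (y : 'I_N -> R) : \det (ev N f y) = vander y * \prod_i f.[y i].
Proof.
have -> : ev N f y = pw N y *m diag_mx (\row_i f.[y i]).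
  by rewrite mul_mx_diag; apply/matrixP=> i j; rewrite !mxE hornerC mul1r mulrC.
by rewrite det_mulmx det_diag; congr (_ * _); apply: eq_bigr => i _; rewrite mxE.
Qed.

Definition fcat n1 n2 (y1 : 'I_n1 -> R) (y2 : 'I_n2 -> R) (i : 'I_(n1 + n2)) :=
  match split i with inl i1 => y1 i1 | inr i2 => y2 i2 end.

Lemma fcatl n1 n2 (y1 : 'I_n1 -> R) (y2 : 'I_n2 -> R) i :
  fcat y1 y2 (lshift n2 i) = y1 i.
Proof. by rewrite /fcat (unsplitK (inl i)). Qed.

Lemma fcatr n1 n2 (y1 : 'I_n1 -> R) (y2 : 'I_n2 -> R) i :
  fcat y1 y2 (rshift n1 i) = y2 i.
Proof. by rewrite /fcat (unsplitK (inr i)). Qed.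

Lemma prod_fcat n1 n2 (y1 : 'I_n1 -> R) (y2 : 'I_n2 -> R) x :
  \prod_i (x - fcat y1 y2 i) = \prod_i (x - y1 i) * \prod_i (x - y2 i).
Proof.
rewrite big_split_ord; congr (_ * _); apply: eq_bigr => i _.
  by rewrite fcatl.
by rewrite fcatr.
Qed.

Lemma pw_cat N n1 n2 (y1 : 'I_n1 -> R) (y2 : 'I_n2 -> R) :
  pw N (fcat y1 y2) = row_mx (pw N y1) (pw N y2).
Proof. by apply/matrixP=> i j; rewrite !mxE /fcat; case: split => k; rewrite !mxE. Qed.

Definition rootpoly n (y : 'I_n -> R) : {poly R} := \prod_i ('X - (y i)%:P).

Lemma rootpoly_monic n (y : 'I_n -> R) : rootpoly y \is monic.
Proof. exact: monic_prod_XsubC. Qed.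

Lemma size_rootpoly n (y : 'I_n -> R) : size (rootpoly y) = n.+1.
Proof. by rewrite /rootpoly -big_enum size_prod_XsubC size_enum_ord. Qed.

Lemma rootpolyE n (y : 'I_n -> R) z : (rootpoly y).[z] = \prod_i (z - y i).
Proof. by rewrite horner_prod; apply: eq_bigr => i _; rewrite hornerXsubC. Qed.

Lemma rootpoly0 n (y : 'I_n -> R) i : (rootpoly y).[y i] = 0.
Proof. by rewrite rootpolyE (bigD1 i) //= subrr mul0r. Qed.

Lemma ev_rootpoly0 N n (y : 'I_n -> R) : ev N (rootpoly y) y = 0.
Proof. by apply/matrixP=> i j; rewrite !mxE rootpoly0 mul0r. Qed.

(** In terms of X^(n1-1) g, ..., g and the lower powers, with g the polynomial whose
    roots are the points of y2, the matrix is block triangular: g vanishes on y2. *)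
Lemma vander_cat N n1 n2 (y1 : 'I_n1 -> R) (y2 : 'I_n2 -> R) : N = (n1 + n2)%N ->
  xdet (row_mx (pw N y1) (pw N y2)) =
  vander y1 * vander y2 * \prod_i \prod_j (y1 i - y2 j).
Proof.
move=> ->.
set g := rootpoly y2.
have gm : g \is monic := rootpoly_monic y2.
have sg : size g = n2.+1 := size_rootpoly y2.
rewrite xdetE -[LHS]mul1r -[X in X * _](det_basis_mx n1 gm sg) -det_mulmx.
rewrite mul_mx_row !basis_mxE ?sg //.
rewrite ev_rootpoly0 -block_mxEh det_lblock vander_mul -/(vander _) mulrAC; congr (_ * _).
by apply: eq_bigr => i _; rewrite rootpolyE.
Qed.

Lemma vander_fcat n1 n2 (y1 : 'I_n1 -> R) (y2 : 'I_n2 -> R) :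
  vander (fcat y1 y2) = vander y1 * vander y2 * \prod_i \prod_j (y1 i - y2 j).
Proof. by rewrite -(vander_cat _ _ erefl) xdetE -pw_cat. Qed.

Lemma vander1 (y : 'I_1 -> R) : vander y = 1.
Proof. by rewrite /vander det_mx11 mxE hornerC mul1r. Qed.

Lemma vander_perm n (y : 'I_n -> R) (s : 'S_n) : vander (y \o s) = (-1) ^+ s * vander y.
Proof.
rewrite /vander (_ : pw n (y \o s) = col_perm s (pw n y)); last first.
  by apply/matrixP=> i j; rewrite !mxE.
by rewrite col_permE det_mulmx det_perm odd_permV mulrC.
Qed.

End Vandermonde.
Arguments mulX {R} N f i.

Lemma vander_neq0 (R : idomainType) n (y : 'I_n -> R) : injective y -> vander y != 0.
Proof.
elim: n y => [|n IHn] y y_inj; first by rewrite /vander det_mx00 oner_eq0.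
have -> : vander y = vander (fcat (pt (y ord0)) (y \o lift ord0)).
  congr (\det _); apply/matrixP=> i j; rewrite !mxE /fcat.
  by case: splitP => k jk; congr (_.[y _] * y _ ^+ _); apply: val_inj; rewrite /= jk ?ord1.
rewrite vander_fcat vander1 mul1r mulf_neq0 //.
  by apply: IHn => i j /= /y_inj /lift_inj.
rewrite big_ord1; apply/prodf_neq0 => j _; rewrite subr_eq0.
by apply/eqP => /y_inj.
Qed.

(** * Signs of block exchanges *)

Section Swaps.
Variable R : comNzRingType.

(** Right multiplication by this matrix exchanges two blocks of columns of any
    matrix; its two sizes b + c and c + b agree only propositionally. *)
Definition swap_mx (S : comNzRingType) b c : 'M[S]_(b + c, c + b) :=
  col_mx (row_mx 0 1%:M) (row_mx 1%:M 0).

Lemma mul_swap_mx (S : comNzRingType) m b c (X : 'M[S]_(m, b)) (Y : 'M_(m, c)) :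
  row_mx X Y *m swap_mx S b c = row_mx Y X.
Proof.
by rewrite mul_row_col !mul_mx_row !mulmx0 !mulmx1 add_row_mx add0r addr0.
Qed.

(** The sign is found over the integers, by comparing the Vandermonde determinants of
    two families of b and c distinct points taken in both orders: by [vander_cat] they
    differ by the sign of b * c differences. *)
Lemma xdet_swap_mx b c : xdet (swap_mx R b c) = (-1) ^+ (b * c).
Proof.
have swapZ : xdet (swap_mx int b c) = (-1) ^+ (b * c).
  pose y1 (i : 'I_b) := (i : nat)%:Z; pose y2 (j : 'I_c) := (b + j)%N%:Z.
  have V1 : vander y1 != 0 by apply: vander_neq0 => i j [] /val_inj.
  have V2 : vander y2 != 0 by apply: vander_neq0 => i j [] /addnI /val_inj.
  have P0 : \prod_i \prod_j (y1 i - y2 j) != 0.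
    apply/prodf_neq0 => i _; apply/prodf_neq0 => j _.
    by rewrite subr_eq0 /y1 /y2; have := ltn_ord i; lia.
  have powE k (u : int) : u ^+ k = \prod_(i < k) u by rewrite prodr_const card_ord.
  apply: (mulfI (mulf_neq0 (mulf_neq0 V1 V2) P0)).
  rewrite -(vander_cat y1 y2 erefl) -xdet_mul ?(addnC c) // mul_swap_mx.
  rewrite !vander_cat ?(addnC c) // (mulrC (vander y2)) -[RHS]mulrA; congr (_ * _).
  rewrite exchange_big /= [RHS]mulrC mulnC exprM powE -big_split /=.
  apply: eq_bigr => i _; rewrite powE -big_split /=.
  by apply: eq_bigr => j _; rewrite mulN1r opprB.
have -> : swap_mx R b c = map_mx intr (swap_mx int b c).
  by rewrite map_col_mx !map_row_mx !map_mx1 !map_mx0.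
by rewrite xdet_map ?(addnC c) // swapZ rmorphXn rmorphN1.
Qed.

Lemma xdet_rowC m n1 n2 (X : 'M[R]_(m, n1)) (Y : 'M_(m, n2)) :
  m = (n1 + n2)%N -> xdet (row_mx X Y) = (-1) ^+ (n1 * n2) * xdet (row_mx Y X).
Proof.
move=> e; rewrite -(mul_swap_mx X Y) xdet_mul ?(addnC n2) // xdet_swap_mx.
by rewrite mulrCA -signr_odd -expr2 sqrr_sign mulr1.
Qed.

Lemma xdet_rowCA m n1 n2 n3 (X : 'M[R]_(m, n1)) (Y : 'M_(m, n2)) (Z : 'M_(m, n3)) :
  m = (n1 + (n2 + n3))%N -> xdet (row_mx X (row_mx Y Z)) =
    (-1) ^+ (n1 * n2) * xdet (row_mx Y (row_mx X Z)).
Proof.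
move=> e; rewrite !xdet_rowA -(mul_swap_mx X Y) xdet_row_mull; try lia.
by rewrite xdet_swap_mx mulrCA -signr_odd -expr2 sqrr_sign mulr1.
Qed.

Lemma xdet_rowCr m n1 n2 n3 (X : 'M[R]_(m, n1)) (Y : 'M_(m, n2)) (Z : 'M_(m, n3)) :
  m = (n1 + (n2 + n3))%N -> xdet (row_mx X (row_mx Y Z)) =
    (-1) ^+ (n2 * n3) * xdet (row_mx X (row_mx Z Y)).
Proof.
move=> e; rewrite -(mul_swap_mx Y Z) xdet_row_mulr; try lia.
by rewrite xdet_swap_mx mulrCA -signr_odd -expr2 sqrr_sign mulr1.
Qed.

Lemma xdet_colC m1 m2 n (X : 'M[R]_(m1, n)) (Y : 'M_(m2, n)) :
  n = (m1 + m2)%N -> xdet (col_mx X Y) = (-1) ^+ (m1 * m2) * xdet (col_mx Y X).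
Proof.
move=> e; rewrite -!(@xdet_tr _ _ _ (col_mx _ _)) ?(addnC m2) // !tr_col_mx.
exact: xdet_rowC.
Qed.

Lemma xdet_colCA m1 m2 m3 n (X : 'M[R]_(m1, n)) (Y : 'M_(m2, n)) (Z : 'M_(m3, n)) :
  n = (m1 + (m2 + m3))%N -> xdet (col_mx X (col_mx Y Z)) =
    (-1) ^+ (m1 * m2) * xdet (col_mx Y (col_mx X Z)).
Proof.
move=> e; rewrite -!(@xdet_tr _ _ _ (col_mx _ _)); try lia; rewrite !tr_col_mx.
exact: xdet_rowCA.
Qed.

Lemma xdet_colCr m1 m2 m3 n (X : 'M[R]_(m1, n)) (Y : 'M_(m2, n)) (Z : 'M_(m3, n)) :
  n = (m1 + (m2 + m3))%N -> xdet (col_mx X (col_mx Y Z)) =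
    (-1) ^+ (m2 * m3) * xdet (col_mx X (col_mx Z Y)).
Proof.
move=> e; rewrite -!(@xdet_tr _ _ _ (col_mx _ _)); try lia; rewrite !tr_col_mx.
exact: xdet_rowCr.
Qed.

End Swaps.

(** * Expansion along sets of columns *)

Section Laplace.
Variable R : comNzRingType.

Lemma col_row3 r1 r2 c1 c2 c3 (X1 : 'M[R]_(r1, c1)) (X2 : 'M_(r1, c2))
    (X3 : 'M_(r1, c3)) (Y1 : 'M_(r2, c1)) (Y2 : 'M_(r2, c2)) (Y3 : 'M_(r2, c3)) :
  col_mx (row_mx X1 (row_mx X2 X3)) (row_mx Y1 (row_mx Y2 Y3)) =
  row_mx (col_mx X1 Y1) (row_mx (col_mx X2 Y2) (col_mx X3 Y3)).
Proof.
rewrite -block_mxEv block_mxEh; congr (row_mx _ _).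
by rewrite -block_mxEv block_mxEh.
Qed.

Definition select_cols N n (S : {set 'I_n}) (X Y : 'M[R]_(N, n)) : 'M_(N, n) :=
  \matrix_(i, j) if j \in S then X i j else Y i j.

(** Multilinearity in the columns, applied to two groups of columns that are sums. *)
Lemma xdet_select N l m n (Z : 'M[R]_(N, l)) (X Y : 'M_(N, m)) (X' Y' : 'M_(N, n)) :
  N = (l + (m + n))%N ->
  xdet (row_mx Z (row_mx (X + Y) (X' + Y'))) =
  \sum_(A : {set 'I_m}) \sum_(B : {set 'I_n})
    xdet (row_mx Z (row_mx (select_cols A X Y) (select_cols B X' Y'))).
Proof.
move=> e; subst N.
have detE (U : 'M[R]_(l + (m + n), l)) V W : xdet (row_mx U (row_mx V W)) =
    \sum_(s : 'S_(l + (m + n))) (-1) ^+ s *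
      ((\prod_j U (s (lshift _ j)) j) *
       ((\prod_j V (s (rshift _ (lshift _ j))) j) *
        (\prod_j W (s (rshift _ (rshift _ j))) j))).
  rewrite xdetE -det_tr; apply: eq_bigr => s _; congr (_ * _).
  rewrite !big_split_ord /=; congr (_ * (_ * _));
    by apply: eq_bigr => j _; rewrite mxE ?row_mxEr ?row_mxEl ?row_mxEr.
rewrite detE; under eq_bigr => s _.
  under [X in _ * (_ * (X * _))]eq_bigr do rewrite mxE.
  under [X in _ * (_ * (_ * X))]eq_bigr do rewrite mxE.
  rewrite !bigA_distr /= big_distrlr /= big_distrr big_distrr /=.
  under eq_bigr do rewrite !big_distrr /=.
  over.
rewrite exchange_big; apply: eq_bigr => A _ /=.
rewrite exchange_big; apply: eq_bigr => B _ /=.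
rewrite detE; apply: eq_bigr => s _; congr (_ * (_ * (_ * _)));
  by apply: eq_bigr => j _; rewrite mxE.
Qed.

(** Every subset with p elements is moved to the first p indices by a permutation.
    Its sign never has to be known: it occurs in the determinant of the selected
    columns and in the Vandermonde determinant of all points, and cancels. *)
Lemma sort_set p m (A : {set 'I_(p + m)}) : #|A| = p ->
  exists s : 'S_(p + m), (forall i, s (lshift m i) \in A) /\
                         (forall i, s (rshift p i) \notin A).
Proof.
move=> cA; case: p A cA => [|p] A cA.
  exists 1%g; split=> i; first by case: i.
  by rewrite (cards0_eq cA) inE.
pose x0 : 'I_(p.+1 + m) := lshift m ord0.
pose r := enum A ++ enum (~: A).
have sA : size (enum A) = p.+1 by rewrite -cardE.
have sC : size (enum (~: A)) = m.
  by rewrite -cardE; have := cardsC A; rewrite card_ord cA => /addnI.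
have ur : uniq r.
  rewrite cat_uniq !enum_uniq andbT /=; apply/hasPn => i.
  by rewrite !mem_enum inE.
have f_inj : injective (fun i : 'I_(p.+1 + m) => nth x0 r i).
  move=> i j /eqP; rewrite nth_uniq ?size_cat ?sA ?sC //.
  by move=> /eqP /val_inj.
exists (perm f_inj); split=> i; rewrite permE nth_cat /= sA.
  by rewrite ltn_ord -mem_enum mem_nth // sA.
rewrite ltnNge leq_addr /= addKn.
have := mem_nth x0 (_ : i < size (enum (~: A)))%N.
by rewrite mem_enum inE; apply; rewrite sC.
Qed.

Section Sorted.
Variables (p m : nat) (A : {set 'I_(p + m)}) (s : 'S_(p + m)).
Hypothesis sA : forall i, s (lshift m i) \in A.
Hypothesis sC : forall i, s (rshift p i) \notin A.

Lemma prod_sorted (F : 'I_(p + m) -> R) :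
  \prod_(i in A) F i = \prod_i F (s (lshift m i)).
Proof.
have -> : \prod_(i in A) F i = \prod_(i | s i \in A) F (s i).
  exact: (reindex_inj (@perm_inj _ s)).
rewrite big_mkcond big_split_ord /= [X in _ * X]big1 ?mulr1.
  by apply: eq_bigr => i _; rewrite sA.
by move=> i _; rewrite (negPf (sC i)).
Qed.

Lemma prod_sortedC (F : 'I_(p + m) -> R) :
  \prod_(i in ~: A) F i = \prod_i F (s (rshift p i)).
Proof.
have -> : \prod_(i in ~: A) F i = \prod_(i | s i \in ~: A) F (s i).
  exact: (reindex_inj (@perm_inj _ s)).
rewrite big_mkcond big_split_ord /=.
rewrite [X in X * _]big1 ?mul1r; last by move=> i _; rewrite inE sA.
by apply: eq_bigr => i _; rewrite inE sC.
Qed.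

Lemma select_sorted N1 N2 (y : 'I_(p + m) -> R) :
  select_cols A (col_mx (pw N1 y) 0) (col_mx 0 (pw N2 y)) =
  row_mx (col_mx (pw N1 (y \o s \o @lshift p m)) 0)
         (col_mx 0 (pw N2 (y \o s \o @rshift p m))) *m perm_mx s.
Proof.
rewrite -[s in perm_mx s]invgK -col_permE; apply/matrixP=> i j.
rewrite [LHS]mxE [RHS]mxE -[j](permKV s) permK.
case: (split_ordP (s^-1%g j)) => j' ->.
  by rewrite sA row_mxEl; case: (split_ordP i) => i' ->;
    rewrite ?col_mxEu ?col_mxEd !mxE.
by rewrite (negPf (sC j')) row_mxEr; case: (split_ordP i) => i' ->;
  rewrite ?col_mxEu ?col_mxEd !mxE.
Qed.

(** The denominator R(Y', Y \ Y') of the double sum is what turns the product of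
    the Vandermonde determinants of Y' and of Y \ Y' into that of Y. *)
Lemma vander_sorted (y : 'I_(p + m) -> R) :
  vander (y \o s \o @lshift p m) * vander (y \o s \o @rshift p m) * Rprod y y A (~: A) =
  (-1) ^+ s * vander y.
Proof.
rewrite -vander_perm /Rprod prod_sorted.
under eq_bigr do rewrite prod_sortedC.
rewrite -(vander_fcat (y \o s \o @lshift p m) (y \o s \o @rshift p m)).
congr (\det _); apply/matrixP=> i j; rewrite !mxE /fcat.
by case: (split_ordP j) => j' ->.
Qed.

End Sorted.
End Laplace.

Section Reassoc.
Variable R : comNzRingType.

(** Associativity inside the first block of a [row_mx], which rewriting with
    [xdet_rowA] does not reach. *)
Lemma xdet_rowAl m n1 n2 n3 n4 (X : 'M[R]_(m, n1)) (Y : 'M_(m, n2))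
    (Z : 'M_(m, n3)) (W : 'M_(m, n4)) :
  xdet (row_mx (row_mx X (row_mx Y Z)) W) = xdet (row_mx (row_mx (row_mx X Y) Z) W).
Proof.
rewrite row_mxA; move: (row_mx (row_mx X Y) Z) (esym _) => U e.
by move: U W; case: _ / e => U W; rewrite castmx_id.
Qed.

Lemma mul_row_diag m n1 n2 r1 r2 (X : 'M[R]_(m, n1)) (Y : 'M_(m, n2))
    (C : 'M_(n1, r1)) (D : 'M_(n2, r2)) :
  row_mx X Y *m col_mx (row_mx C 0) (row_mx 0 D) = row_mx (X *m C) (Y *m D).
Proof. by rewrite mul_row_col !mul_mx_row !mulmx0 add_row_mx addr0 add0r. Qed.

Lemma xdet_perm n (s : 'S_n) : xdet (perm_mx s : 'M[R]_n) = (-1) ^+ s.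
Proof. by rewrite xdetE det_perm. Qed.

Lemma row_col0 r1 r2 n1 n2 (X : 'M[R]_(r1, n1)) (Y : 'M_(r1, n2)) :
  row_mx (col_mx X 0) (col_mx Y 0) = col_mx (row_mx X Y) 0 :> 'M_(r1 + r2, _).
Proof. by rewrite -block_mxEh block_mxEv row_mx0. Qed.

Lemma row_0col r1 r2 n1 n2 (X : 'M[R]_(r2, n1)) (Y : 'M_(r2, n2)) :
  row_mx (col_mx 0 X) (col_mx 0 Y) = col_mx 0 (row_mx X Y) :> 'M_(r1 + r2, _).
Proof. by rewrite -block_mxEh block_mxEv row_mx0. Qed.

Lemma xdet_row_shuffle m n1 n2 n3 n4 n5 (Z : 'M[R]_(m, n1)) (P1 : 'M_(m, n2))
    (P2 : 'M_(m, n3)) (Q1 : 'M_(m, n4)) (Q2 : 'M_(m, n5)) :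
  m = (n1 + ((n2 + n3) + (n4 + n5)))%N ->
  xdet (row_mx Z (row_mx (row_mx P1 P2) (row_mx Q1 Q2))) =
  (-1) ^+ (n3 * n4) * xdet (row_mx (row_mx Z (row_mx P1 Q1)) (row_mx P2 Q2)).
Proof.
move=> e; rewrite xdet_rowA xdet_rowAl -xdet_rowA.
set X := row_mx Z P1; set W := row_mx (row_mx Q1 P2) Q2.
have -> : xdet (row_mx X (row_mx P2 (row_mx Q1 Q2))) =
          xdet (row_mx X (row_mx (row_mx P2 Q1) Q2)).
  by rewrite xdet_rowA xdet_rowA -xdet_rowAl -xdet_rowA.
have -> : row_mx (row_mx P2 Q1) Q2 =
    W *m col_mx (row_mx (swap_mx R n4 n3) 0) (row_mx 0 1%:M).
  by rewrite mul_row_diag mul_swap_mx mulmx1.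
rewrite xdet_row_mulr ?xdet_ublock; try lia.
rewrite xdet1 mulr1 xdet_swap_mx mulnC mulrC; congr (_ * _).
by rewrite /W xdet_rowA xdet_rowAl -xdet_rowA /X -xdet_rowAl.
Qed.

End Reassoc.

(** Multiplying the rows of P by X is the same as multiplying its columns by X, so
    the determinant M satisfies X^m1 M = X^n1 M over the polynomials. *)
Lemma xdet_block_neq0 (R : idomainType) m1 m2 n1 n2 (P : 'M[R]_(m1, n1))
    (Q : 'M_(m2, n2)) : (m1 + m2 = n1 + n2)%N -> m1 != n1 ->
  xdet (col_mx (row_mx P 0) (row_mx 0 Q)) = 0.
Proof.
move=> e ne; set M := col_mx _ _; apply/eqP; rewrite -polyC_eq0 -xdet_map //; apply/eqP.
pose sc r1 r2 : 'M[{poly R}]_(r1 + r2) := col_mx (row_mx 'X%:M 0) (row_mx 0 1%:M).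
have sc_det r1 r2 : xdet (sc r1 r2) = 'X^r1.
  by rewrite xdet_ublock // xdet1 mulr1 xdetE det_scalar.
have scE : sc m1 m2 *m map_mx polyC M = map_mx polyC M *m sc n1 n2.
  rewrite /M /sc map_col_mx !map_row_mx !map_mx0 -!block_mxEv !mulmx_block.
  by rewrite !mul0mx !mulmx0 !mulmx1 !mul1mx mul_mx_scalar mul_scalar_mx.
have /eqP := congr1 (@xdet _ _ _) scE; rewrite !xdet_mul // !sc_det mulrC -subr_eq0.
rewrite -mulrBr mulf_eq0 => /orP[/eqP //|].
rewrite subr_eq0 => /eqP /(congr1 (fun h : {poly R} => size h)).
by rewrite !size_polyXn => -[/eqP]; rewrite (negPf ne).
Qed.

Section Expansion.
Variables (R : idomainType).

(** The term of the expansion of the generating determinant in which the columns of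
    index in A and B, and the column of x, are taken from the upper d1 rows, and the
    other columns from the lower k1 rows. *)
Definition sylv_term m n (a : 'I_m -> R) (b : 'I_n -> R) x d1 k1 A B : R :=
  xdet (row_mx (col_mx (pw d1 (pt x)) 0)
    (row_mx (select_cols A (col_mx (pw d1 a) 0) (col_mx 0 (pw k1 a)))
            (select_cols B (col_mx (pw d1 b) 0) (col_mx 0 (pw k1 b))))).

Section Term.
Variables (p m1 q n1 d1 k1 : nat) (a : 'I_(p + m1) -> R) (b : 'I_(q + n1) -> R) (x : R).
Variables (A : {set 'I_(p + m1)}) (B : {set 'I_(q + n1)}).
Hypotheses (cA : #|A| = p) (cB : #|B| = q).
Hypothesis e : (d1 + k1 = 1 + ((p + m1) + (q + n1)))%N.

Section Sorted.
Variables (s : 'S_(p + m1)) (r : 'S_(q + n1)).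
Hypothesis sA : forall i, s (lshift m1 i) \in A.
Hypothesis sC : forall i, s (rshift p i) \notin A.
Hypothesis rB : forall i, r (lshift n1 i) \in B.
Hypothesis rC : forall i, r (rshift q i) \notin B.
Let a1 := a \o s \o @lshift p m1.
Let a2 := a \o s \o @rshift p m1.
Let b1 := b \o r \o @lshift q n1.
Let b2 := b \o r \o @rshift q n1.

Lemma sylv_term_sorted : sylv_term a b x d1 k1 A B =
  (-1) ^+ (m1 * q) * ((-1) ^+ s * (-1) ^+ r) *
  xdet (col_mx (row_mx (pw d1 (fcat (pt x) (fcat a1 b1))) 0)
               (row_mx 0 (pw k1 (fcat a2 b2)))).
Proof.
rewrite /sylv_term (select_sorted sA sC) (select_sorted rB rC) -/a1 -/a2 -/b1 -/b2.
rewrite -mul_row_diag xdet_row_mulr // (@xdet_ublock _ _ _ _ _ (perm_mx s)) // !xdet_perm.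
rewrite xdet_row_shuffle //.
rewrite mulrAC; congr (_ * _ * _).
by rewrite !row_col0 row_0col -block_mxEh block_mxEv !pw_cat.
Qed.

End Sorted.

(** The upper diagonal block has d1 rows and 1 + p + q columns; when it is not square
    the lower one is not either, and the determinant vanishes. *)
Lemma sylv_term_sized0 : d1 != (1 + (p + q))%N -> sylv_term a b x d1 k1 A B = 0.
Proof.
move=> ne; have [s [sA sC]] := sort_set cA; have [r [rB rC]] := sort_set cB.
by rewrite (sylv_term_sorted sA sC rB rC) xdet_block_neq0 ?mulr0 //; lia.
Qed.

(** Both diagonal blocks are Vandermonde matrices, of (x, A', B') and of
    (A \ A', B \ B'). Bringing the columns in this order exchanges A \ A' with B',
    hence the sign. *)
Lemma sylv_term_sized : d1 = (1 + (p + q))%N ->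
  sylv_term a b x d1 k1 A B * (Rprod a a A (~: A) * Rprod b b B (~: B)) =
  (-1) ^+ (m1 * q) * (vander a * vander b) * (Rprod a b A B * Rprod a b (~: A) (~: B)) *
  (\prod_(i in A) (x - a i) * \prod_(j in B) (x - b j)).
Proof.
move=> ed; have [s [sA sC]] := sort_set cA; have [r [rB rC]] := sort_set cB.
rewrite (sylv_term_sorted sA sC rB rC) xdet_ublock //; last by lia.
set va := vander a; set vb := vander b.
have -> : va = (-1) ^+ s * ((-1) ^+ s * va) by rewrite mulrA -expr2 sqrr_sign mul1r.
have -> : vb = (-1) ^+ r * ((-1) ^+ r * vb) by rewrite mulrA -expr2 sqrr_sign mul1r.
rewrite -(vander_sorted sA sC) -(vander_sorted rB rC).
subst d1; have ek : k1 = (m1 + n1)%N by lia.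
subst k1; rewrite !xdetE -!/(vander _) !vander_fcat vander1 big_ord1 prod_fcat.
rewrite (prod_sorted sA sC (fun i => x - a i)) (prod_sorted rB rC (fun j => x - b j)).
have -> : Rprod a b A B =
    \prod_(i < p) \prod_(j < q) (a (s (lshift m1 i)) - b (r (lshift n1 j))).
  rewrite /Rprod (prod_sorted sA sC); apply: eq_bigr => i _.
  exact: (prod_sorted rB rC).
have -> : Rprod a b (~: A) (~: B) =
    \prod_(i < m1) \prod_(j < n1) (a (s (rshift p i)) - b (r (rshift q j))).
  rewrite /Rprod (prod_sortedC sA sC); apply: eq_bigr => i _.
  exact: (prod_sortedC rB rC).
have reorder (u0 u1 u2 v1 v2 v3 v4 c1 c2 c3 c4 z1 z2 : R) :
    u0 * (u1 * u2) * (1 * (v1 * v3 * c1) * (z1 * z2) * (v2 * v4 * c2)) * (c3 * c4) =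
    u0 * (u1 * (v1 * v2 * c3) * (u2 * (v3 * v4 * c4))) * (c1 * c2) * (z1 * z2).
  by ring.
exact: reorder.
Qed.

End Term.

Section AnySize.
Variables (m n d1 k1 : nat) (a : 'I_m -> R) (b : 'I_n -> R) (x : R).
Variables (A : {set 'I_m}) (B : {set 'I_n}).
Hypothesis e : (d1 + k1 = 1 + (m + n))%N.

Lemma sylv_term0 : d1 != (1 + (#|A| + #|B|))%N -> sylv_term a b x d1 k1 A B = 0.
Proof.
have [m1 em] : exists m1, m = (#|A| + m1)%N.
  by exists (m - #|A|)%N; have := max_card A; rewrite card_ord; lia.
have [n1 en] : exists n1, n = (#|B| + n1)%N.
  by exists (n - #|B|)%N; have := max_card B; rewrite card_ord; lia.
set p := #|A| in em *; have cA : #|A| = p by []; clearbody p.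
set q := #|B| in en *; have cB : #|B| = q by []; clearbody q.
by subst m n; apply: sylv_term_sized0.
Qed.

Lemma sylv_termE : d1 = (1 + (#|A| + #|B|))%N ->
  sylv_term a b x d1 k1 A B * (Rprod a a A (~: A) * Rprod b b B (~: B)) =
  (-1) ^+ ((m - #|A|) * #|B|) * (vander a * vander b) *
  (Rprod a b A B * Rprod a b (~: A) (~: B)) *
  (\prod_(i in A) (x - a i) * \prod_(j in B) (x - b j)).
Proof.
have [m1 em] : exists m1, m = (#|A| + m1)%N.
  by exists (m - #|A|)%N; have := max_card A; rewrite card_ord; lia.
have [n1 en] : exists n1, n = (#|B| + n1)%N.
  by exists (n - #|B|)%N; have := max_card B; rewrite card_ord; lia.
set p := #|A| in em *; have cA : #|A| = p by []; clearbody p.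
set q := #|B| in en *; have cB : #|B| = q by []; clearbody q.
by subst m n; rewrite addKn; apply: sylv_term_sized.
Qed.

End AnySize.
End Expansion.

(** * The generating determinant of the double sums *)

(** The upper rows have the powers in degrees d1 - 1, ..., 0 and the lower rows those
    in degrees k1 - 1, ..., 0. The variable t marks the columns of A taken from the
    upper rows, so that its exponent records the size of the subset of A. *)
Definition dbl_det (R : comNzRingType) m n d1 k1 (a : 'I_m -> R) (b : 'I_n -> R) x t : R :=
  xdet (col_mx
    (row_mx (pw d1 (pt x)) (row_mx (t *: pw d1 a) (pw d1 b)))
    (row_mx 0 (row_mx (pw k1 a) (pw k1 b)))).

Lemma dbl_det_expand (R : idomainType) m n d1 k1 (a : 'I_m -> R) (b : 'I_n -> R) x t :
  (d1 + k1 = 1 + (m + n))%N ->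
  dbl_det d1 k1 a b x t =
    \sum_(A : {set 'I_m}) \sum_(B : {set 'I_n}) t ^+ #|A| * sylv_term a b x d1 k1 A B.
Proof.
move=> e; rewrite /dbl_det col_row3.
have -> : col_mx (t *: pw d1 a) (pw k1 a) = col_mx (t *: pw d1 a) 0 + col_mx 0 (pw k1 a).
  by rewrite add_col_mx addr0 add0r.
have -> : col_mx (pw d1 b) (pw k1 b) = col_mx (pw d1 b) 0 + col_mx 0 (pw k1 b).
  by rewrite add_col_mx addr0 add0r.
rewrite xdet_select //; apply: eq_bigr => A _; apply: eq_bigr => B _.
pose C : 'M[R]_m := diag_mx (\row_j (if j \in A then t else 1)).
have -> : select_cols A (col_mx (t *: pw d1 a) 0) (col_mx 0 (pw k1 a)) =
    select_cols A (col_mx (pw d1 a) 0) (col_mx 0 (pw k1 a)) *m C.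
  rewrite mul_mx_diag; apply/matrixP=> i j; rewrite [LHS]mxE [RHS]mxE !mxE.
  by case: ifP => _; rewrite ?mulr1 //; case: splitP => i' _; rewrite !mxE ?mul0r 1?mulrC.
rewrite -[select_cols B _ _]mulmx1 -mul_row_diag xdet_row_mulr // mulrC; congr (_ * _).
rewrite (@xdet_ublock _ _ _ _ _ C) // xdet1 mulr1 xdetE det_diag.
rewrite -prodr_const [RHS]big_mkcond /=.
by apply: eq_bigr => j _; rewrite mxE.
Qed.

Section Map.
Variables (R S : comNzRingType) (phi : {rmorphism R -> S}).

Lemma map_ev N h M (y : 'I_M -> R) :
  map_mx phi (ev N h y) = ev N (map_poly phi h) (phi \o y).
Proof. by apply/matrixP=> i j; rewrite !mxE rmorphM rmorphXn /= horner_map. Qed.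

Lemma map_pw N M (y : 'I_M -> R) : map_mx phi (pw N y) = pw N (phi \o y).
Proof. by rewrite /pw map_ev rmorph1. Qed.

Lemma vander_map N (y : 'I_N -> R) : vander (phi \o y) = phi (vander y).
Proof. by rewrite /vander -map_pw det_map_mx. Qed.

Lemma Rprod_map (I J : finType) (y : I -> R) (z : J -> R) Y Z :
  Rprod (phi \o y) (phi \o z) Y Z = phi (Rprod y z Y Z).
Proof.
rewrite /Rprod rmorph_prod; apply: eq_bigr => i _.
by rewrite rmorph_prod; apply: eq_bigr => j _; rewrite rmorphB.
Qed.

End Map.

Lemma sylv_term_map (R S : idomainType) (phi : {rmorphism R -> S}) m n
    (a : 'I_m -> R) (b : 'I_n -> R) x d1 k1 A B :
  (d1 + k1 = 1 + (m + n))%N ->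
  sylv_term (phi \o a) (phi \o b) (phi x) d1 k1 A B = phi (sylv_term a b x d1 k1 A B).
Proof.
move=> e; rewrite /sylv_term -xdet_map // !map_row_mx map_col_mx map_pw map_mx0.
have map_sel l (Y : 'I_l -> R) (C : {set 'I_l}) :
    map_mx phi (select_cols C (col_mx (pw d1 Y) 0) (col_mx 0 (pw k1 Y))) =
    select_cols C (col_mx (pw d1 (phi \o Y)) 0) (col_mx 0 (pw k1 (phi \o Y))).
  rewrite -!map_pw; apply/matrixP=> i j; rewrite !mxE.
  by case: ifP; case: splitP => i' _ _; rewrite !mxE ?rmorph0.
by rewrite !map_sel.
Qed.

Lemma Rprod_compl_neq0 (R : idomainType) (I : finType) (y : I -> R) (Y : {set I}) :
  injective y -> Rprod y y Y (~: Y) != 0.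
Proof.
move=> y_inj; apply/prodf_neq0 => i iY; apply/prodf_neq0 => j.
rewrite inE => jY; rewrite subr_eq0; apply: contra jY => /eqP /y_inj <- //.
Qed.

Section Coefficient.
Variables (K : fieldType) (m n : nat) (a : 'I_m -> K) (b : 'I_n -> K).
Hypotheses (a_inj : injective a) (b_inj : injective b).

(** The generating determinant with x and t both indeterminate: x is the inner
    polynomial variable and t the outer one. *)
Definition gen_det d1 k1 : {poly {poly K}} :=
  dbl_det d1 k1 (polyC \o (polyC \o a)) (polyC \o (polyC \o b)) ('X%:P) 'X.

(** In the expansion over subsets the power of t retains the subsets of A of size p,
    and then only the subsets of B of size q give square blocks. *)
Lemma coef_gen_det p q d1 k1 :
  (p <= m)%N -> d1 = (1 + (p + q))%N -> (d1 + k1 = 1 + (m + n))%N ->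
  (gen_det d1 k1)`_p =
  (-1) ^+ (q * (m - p)) * (vander a * vander b)%:P * Sylv a b p q.
Proof.
move=> pm ed e; rewrite /gen_det dbl_det_expand // coef_sum /Sylv big_distrr /=.
rewrite (bigID (fun A : {set 'I_m} => #|A| == p)) /= [X in _ + X]big1 ?addr0; last first.
  move=> A ne; rewrite coef_sum big1 // => B _.
  rewrite (sylv_term_map (@polyC _)) // coefMC coefXn eq_sym (negPf ne).
  by rewrite mul0r.
apply: eq_bigr => A /eqP cA; rewrite coef_sum big_distrr /=.
rewrite (bigID (fun B : {set 'I_n} => #|B| == q)) /= [X in _ + X]big1 ?addr0; last first.
  move=> B ne; rewrite sylv_term0 ?mulr0 ?coef0 // cA ed.
  by apply: contra ne => /eqP /addnI /addnI ->.
apply: eq_bigr => B /eqP cB.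
rewrite (sylv_term_map (@polyC _)) // coefMC coefXn cA eqxx mul1r.
have den0 : (Rprod a a A (~: A) * Rprod b b B (~: B))%:P != 0.
  by rewrite polyC_eq0 mulf_neq0 ?Rprod_compl_neq0.
apply: (mulIf den0).
have := @sylv_termE _ _ _ _ _ (polyC \o a) (polyC \o b) 'X A B e.
rewrite cA cB => /(_ ed); rewrite !Rprod_map !vander_map -!rmorphM /= => ->.
rewrite mulnC -[RHS]mulrA -[LHS]mulrA; congr (_ * _).
rewrite -mul_polyC mulrAC -polyCM divfK; last by rewrite -polyC_eq0.
rewrite /RprodX; reflexivity.
Qed.

End Coefficient.

(** * Reduction of the subresultant matrix modulo g *)

Section ModuloRootpoly.
Variables (R : comNzRingType) (N1 N2 n d1 k1 : nat) (f : {poly R}) (b : 'I_n -> R).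
Let g := rootpoly b.
Hypotheses (hf : (size f + N1 <= k1.+1)%N) (hk : k1 = (N2 + n)%N).
Hypotheses (hd : (d1 <= n)%N) (hsq : (N1 + d1 = n + 1)%N).

(** The rows of the subresultant matrix, with all their coefficients, completed by the
    powers in degrees d1 - 1, ..., 0. The latter clear the columns of these degrees,
    which are the ones missing from the subresultant matrix. *)
Definition sylv_rows (h : {poly R}) : 'M[R]_((N1 + N2) + d1, k1) :=
  col_mx (col_mx (coef_mx k1 (mulX N1 f)) (coef_mx k1 (mulX N2 h))) (coef_mx k1 (mulX d1 1)).

(** The linear forms given by the coefficients in degrees at least n and by the values
    at b are obtained from the coefficients by a matrix of determinant V(b). In these
    coordinates the multiples of g vanish at b and their leading coefficients form a
    unitriangular block, which splits off. *)
Lemma xdet_sylv_rows_mod (u : 'cV[R]_N1) (w : 'cV_d1) :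
  vander b * xdet (row_mx (sylv_rows g) (col_mx (col_mx u 0) w)) =
  (-1) ^+ (N1 * N2) *
  xdet (col_mx (row_mx (ev N1 f b) u) (row_mx (pw d1 b) w)).
Proof.
rewrite /sylv_rows; move: hf => hf1; subst k1.
(* The first N2 columns of E keep the coefficients in degrees at least n. *)
pose E : 'M[R]_(N2 + n, N2 + n) := row_mx (col_mx 1%:M 0) (pw (N2 + n) b).
have detE : xdet E = vander b.
  rewrite /E -[pw _ b]vsubmxK -block_mxEh block_mxEv xdet_ublock // xdet1 mul1r.
  rewrite xdetE; congr (\det _); apply/matrixP=> i j; rewrite !mxE /=.
  by congr (_ * _ ^+ _); lia.
have mulE r (q : 'I_r -> {poly R}) : coef_mx (N2 + n) q *m E =
    row_mx (lsubmx (coef_mx (N2 + n) q)) (coef_mx (N2 + n) q *m pw (N2 + n) b).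
  by rewrite mul_mx_row -{1}[coef_mx _ _]hsubmxK mul_row_col mulmx1 mulmx0 addr0.
rewrite -detE mulrC -xdet_row_mull; try lia.
rewrite !mul_col_mx !mulE !coef_mx_mulX ?size_poly1 ?size_rootpoly //; try lia.
rewrite ev_rootpoly0 -/(pw _ _).
have -> : lsubmx (coef_mx (N2 + n) (mulX d1 1)) = 0 :> 'M[R]_(d1, N2).
  apply/matrixP=> i l; rewrite !mxE /mulX mul1r coefXn /= (_ : (_ == _) = false) //.
  by have := ltn_ord i; have := ltn_ord l; lia.
set Lf := lsubmx _; set Lg := lsubmx _.
have detLg : xdet Lg = 1.
  by rewrite xdetE det_coef_mx_monic ?rootpoly_monic ?size_rootpoly.
have -> : row_mx (col_mx (col_mx (row_mx Lf (ev N1 f b)) (row_mx Lg 0))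
                    (row_mx 0 (pw d1 b))) (col_mx (col_mx u 0) w) =
    row_mx (row_mx (col_mx (col_mx Lf Lg) 0)
                   (col_mx (col_mx (ev N1 f b) 0) (pw d1 b)))
           (col_mx (col_mx u 0) w).
  congr (row_mx _ _); rewrite -[RHS]block_mxEh block_mxEv; congr (col_mx _ _).
  by rewrite -[RHS]block_mxEh block_mxEv.
rewrite -xdet_rowA -!col_row3 -xdet_colA xdet_colCA; try lia.
rewrite row_mx0; congr (_ * _).
have -> : col_mx (row_mx Lf (row_mx (ev N1 f b) u)) (row_mx 0 (row_mx (pw d1 b) w)) =
    row_mx (col_mx Lf 0) (col_mx (row_mx (ev N1 f b) u) (row_mx (pw d1 b) w)).
  by rewrite -block_mxEh block_mxEv.
by rewrite xdet_lblock ?detLg ?mul1r.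
Qed.

End ModuloRootpoly.

Lemma coef_mulX_coefz (R : comNzRingType) N m k c (p : {poly R}) (i : 'I_N) :
  k = (N + m)%N -> (c < k)%N ->
  (mulX N (map_poly polyC p) i)`_(k - c.+1) = (coefz p (m%:Z + i%:Z - c%:Z))%:P.
Proof.
move=> -> ck; rewrite /mulX coefMXn; have iN := ltn_ord i; case: ifP => hlt.
  have -> : m%:Z + i%:Z - c%:Z = Negz (c - m - i).-1 by lia.
  by rewrite polyC0.
have -> : m%:Z + i%:Z - c%:Z = Posz (m + i - c)%N by lia.
by rewrite coef_map /=; congr (_`_ _)%:P; lia.
Qed.

Lemma map_rootpoly (R : comNzRingType) k (y : 'I_k -> R) :
  map_poly polyC (rootpoly y) = rootpoly (polyC \o y).
Proof.
rewrite /rootpoly rmorph_prod; apply: eq_bigr => i _.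
by rewrite rmorphB /= map_polyX map_polyC.
Qed.

Section SubresultantMatrix.
Variables (R : comNzRingType) (m n j : nat) (f g : {poly R}).
Hypotheses (jm : (j <= m)%N) (jn : (j < n)%N).
Let N1 := (n - j)%N.
Let N2 := (m - j)%N.
Let fP : {poly {poly R}} := map_poly polyC f.
Let gP : {poly {poly R}} := map_poly polyC g.

(** The last d1 = j + 1 rows vanish outside the columns of degrees j, ..., 0, where they
    form the identity; the sign comes from moving the last column across these columns. *)
Lemma xdet_sylv_rows_sres (u : 'I_N1 -> {poly R}) (v : 'I_N2 -> {poly R}) :
  xdet (row_mx (sylv_rows N1 N2 j.+1 (N1 + m) fP gP)
          (col_mx (col_mx (\col_i u i) (\col_i v i)) 0)) =
  (-1) ^+ j.+1 * \det (@sres_mx R m n j f g u v).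
Proof.
have [h hh] : exists h, (N1 + N2 = h + 1)%N.
  by exists (N1 + N2).-1; rewrite addn1 prednK // /N1; lia.
have ek : (N1 + m = h + j.+1)%N by lia.
rewrite /sylv_rows.
pose H := lsubmx (castmx (erefl, ek)
  (col_mx (coef_mx (N1 + m) (mulX N1 fP)) (coef_mx (N1 + m) (mulX N2 gP)))).
pose L := rsubmx (castmx (erefl, ek)
  (col_mx (coef_mx (N1 + m) (mulX N1 fP)) (coef_mx (N1 + m) (mulX N2 gP)))).
set U := col_mx (\col_i u i) (\col_i v i).
have -> : xdet (row_mx (col_mx (col_mx (coef_mx (N1 + m) (mulX N1 fP))
      (coef_mx (N1 + m) (mulX N2 gP))) (coef_mx (N1 + m) (mulX j.+1 1))) (col_mx U 0)) =
    xdet (row_mx (row_mx (col_mx H 0) (col_mx L 1%:M)) (col_mx U 0)).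
  have -> : row_mx (col_mx H 0) (col_mx L 1%:M) =
     castmx (erefl, ek) (col_mx (col_mx (coef_mx (N1 + m) (mulX N1 fP))
      (coef_mx (N1 + m) (mulX N2 gP))) (coef_mx (N1 + m) (mulX j.+1 1))).
    rewrite -block_mxEh block_mxEv hsubmxK.
    apply/matrixP=> r c; rewrite castmxE /= cast_ord_id.
    case: (split_ordP r) => i ->; rewrite ?col_mxEu ?col_mxEd.
      by rewrite castmxE cast_ord_id.
    rewrite [RHS]mxE /mulX mul1r coefXn.
    case: (split_ordP c) => l ->; rewrite ?row_mxEl ?row_mxEr !mxE /=.
      by rewrite (_ : (_ == _) = false) //; have := ltn_ord l; lia.
    congr (nat_of_bool _)%:R; apply/idP/idP; first by move/eqP ->; lia.
    move=> il; apply/eqP; apply: val_inj => /=.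
    by have := ltn_ord l; have := ltn_ord i; lia.
  move: ek {H L} => ek; move: (col_mx (col_mx _ _) _).
  by case: _ / ek => M; rewrite castmx_id.
rewrite -xdet_rowA xdet_rowCr; try lia.
rewrite muln1; congr (_ * _); rewrite xdet_rowA row_col0 -block_mxEh block_mxEv.
rewrite xdet_ublock ?xdet1 ?mulr1 //; try lia.
rewrite -xdetE -(xdet_cast (erefl, hh)); congr (xdet _).
apply/matrixP=> r c; rewrite castmxE [RHS]mxE cast_ord_id /= /U.
case: (split_ordP c) => l cE; rewrite cE.
  have lh := ltn_ord l; rewrite row_mxEl.
  have -> : ((lshift 1 l).+1 == (n - j + (m - j)))%N = false.
    by apply/eqP => /=; move: hh; rewrite /N1 /N2; lia.
  rewrite /H mxE castmxE cast_ord_id.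
  case: (split_ordP r) => i ->; rewrite ?col_mxEu ?col_mxEd mxE /=;
    by apply: coef_mulX_coefz; clear -ek hh lh jm jn; move: ek hh lh; rewrite /N1 /N2; lia.
rewrite row_mxEr.
have -> : ((rshift h l).+1 == (n - j + (m - j)))%N.
  by apply/eqP; rewrite ord1 /=; move: hh; rewrite /N1 /N2; lia.
by case: (split_ordP r) => i ->; rewrite ?col_mxEu ?col_mxEd mxE.
Qed.

Section RootpolyB.
Variables (b : 'I_n -> R).
Hypotheses (hf : (size f <= m.+1)%N) (hg : g = rootpoly b).
Let bP : 'I_n -> {poly R} := polyC \o b.

(** This serves as the expression of F_j in the values of f at the roots of g. *)
Lemma xdet_sresF (u : 'I_N1 -> {poly R}) :
  xdet (col_mx (row_mx (ev N1 fP bP) (\col_i u i)) (row_mx (pw j.+1 bP) 0)) =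
  (-1) ^+ (N1 * N2 + j.+1) * vander bP * \det (@sres_mx R m n j f g u (fun=> 0)).
Proof.
have szf : (size fP <= m.+1)%N by rewrite (leq_trans (size_poly _ _)).
have h1 : (size fP + N1 <= (N1 + m).+1)%N by rewrite addnC -addnS leq_add2l.
have h2 : (N1 + m = N2 + n)%N by rewrite /N1 /N2; lia.
have h3 : (j.+1 <= n)%N by [].
have h4 : (N1 + j.+1 = n + 1)%N by rewrite /N1; lia.
have := @xdet_sylv_rows_mod _ N1 N2 n j.+1 (N1 + m) fP bP h1 h2 h3 h4 (\col_i u i) 0.
rewrite -map_rootpoly -hg -/gP => E.
have zE : 0 = \col_(i < N2) (0 : {poly R}) by apply/matrixP=> i c; rewrite !mxE.
move: E; rewrite {1}zE (xdet_sylv_rows_sres u (fun=> 0)) => E.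
apply: (can_inj (signrMK (N1 * N2))) => /=.
by rewrite -E exprD -!mulrA signrMK mulrCA.
Qed.

(** Subtracting from the last column the combination of the others with coefficients
    the powers of X cancels the entries X^i f and X^i g, and leaves -X^i in the rows
    of the powers; the multiples of g can then be eliminated as before. *)
Lemma xdet_Sres :
  xdet (col_mx (row_mx (ev N1 fP bP) 0)
               (row_mx (pw j.+1 bP) (pw j.+1 (pt 'X)))) =
  (-1) ^+ (N1 * N2 + j) * vander bP * Sres m n j f g.
Proof.
have szf : (size fP <= m.+1)%N by rewrite (leq_trans (size_poly _ _)).
have szg : (size gP <= n.+1)%N by rewrite (leq_trans (size_poly _ _)) // hg size_rootpoly.
pose X : 'I_1 -> {poly R} := fun=> 'X.
have evX N (h : {poly R}) : ev N (map_poly polyC h) X = \col_i ('X^(N - i.+1) * h).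
  apply/matrixP=> i c; rewrite !mxE /X -[_.['X]]/(h \Po 'X) comp_polyXr.
  by rewrite mulrC.
have := xdet_sylv_rows_sres (fun i => 'X^(N1 - i.+1) * f) (fun i => 'X^(N2 - i.+1) * g).
rewrite -!evX -/fP -/gP -/(Sres m n j f g).
have h1 : (size fP + N1 <= (N1 + m).+1)%N by rewrite addnC -addnS leq_add2l.
have h2 : (N1 + m = N2 + n)%N by rewrite /N1 /N2; lia.
have h1' : (size gP + N2 <= (N1 + m).+1)%N by rewrite h2 addnC -addnS leq_add2l.
have -> : col_mx (col_mx (ev N1 fP X) (ev N2 gP X)) 0 =
    col_mx (col_mx 0 0) (- pw j.+1 X) +
    sylv_rows N1 N2 j.+1 (N1 + m) fP gP *m pw (N1 + m) X.
  rewrite /sylv_rows !mul_col_mx !coef_mx_mulX ?size_poly1 //; last by rewrite /N1; lia.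
  by rewrite !add_col_mx !add0r addNr.
rewrite xdet_row_addr; last by rewrite /N1 /N2; lia.
have h3 : (j.+1 <= n)%N by [].
have h4 : (N1 + j.+1 = n + 1)%N by rewrite /N1; lia.
have := @xdet_sylv_rows_mod _ N1 N2 n j.+1 (N1 + m) fP bP h1 h2 h3 h4 0 (- pw j.+1 X).
rewrite -map_rootpoly -hg -/gP => E Esres.
move: E; rewrite {}Esres => E.
have -> : col_mx (row_mx (ev N1 fP bP) 0) (row_mx (pw j.+1 bP) (pw j.+1 X)) =
   row_mx (col_mx (ev N1 fP bP) (pw j.+1 bP)) (col_mx 0 (- pw j.+1 X) *m (- 1%:M)).
  by rewrite mulmxN mulmx1 opp_col_mx oppr0 opprK -block_mxEh block_mxEv.
rewrite xdet_row_mulr //.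
rewrite -block_mxEh block_mxEv.
have -> : xdet (- 1%:M : 'M[{poly R}]_1) = -1 by rewrite xdetE det_mx11 !mxE.
apply: (can_inj (signrMK (N1 * N2))) => /=.
rewrite [LHS]mulrA -E exprS exprD -!mulrA signrMK mulrN1 mulN1r.
by rewrite !mulrN opprK mulrCA.
Qed.
End RootpolyB.

End SubresultantMatrix.

(** * Three by three block matrices *)

Section Blocks.
Variables (R : comNzRingType) (m1 m2 m3 n1 n2 n3 : nat).

Definition mx22 (A11 : 'M[R]_(m1, n1)) (A12 : 'M_(m1, n2))
    (A21 : 'M_(m2, n1)) (A22 : 'M_(m2, n2)) : 'M_(m1 + m2, n1 + n2) :=
  col_mx (row_mx A11 A12) (row_mx A21 A22).

Definition mx33 (A11 : 'M[R]_(m1, n1)) (A12 : 'M_(m1, n2)) (A13 : 'M_(m1, n3))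
    (A21 : 'M_(m2, n1)) (A22 : 'M_(m2, n2)) (A23 : 'M_(m2, n3))
    (A31 : 'M_(m3, n1)) (A32 : 'M_(m3, n2)) (A33 : 'M_(m3, n3)) :
    'M_(m1 + (m2 + m3), n1 + (n2 + n3)) :=
  col_mx (row_mx A11 (row_mx A12 A13))
    (col_mx (row_mx A21 (row_mx A22 A23)) (row_mx A31 (row_mx A32 A33))).

End Blocks.

Section BlockDet.
Variables (R : comNzRingType) (m1 m2 m3 n1 n2 n3 : nat).
Variables (A11 : 'M[R]_(m1, n1)) (A12 : 'M[R]_(m1, n2)) (A13 : 'M[R]_(m1, n3)).
Variables (A21 : 'M[R]_(m2, n1)) (A22 : 'M[R]_(m2, n2)) (A23 : 'M[R]_(m2, n3)).
Variables (A31 : 'M[R]_(m3, n1)) (A32 : 'M[R]_(m3, n2)) (A33 : 'M[R]_(m3, n3)).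
Hypothesis e : (n1 + (n2 + n3) = m1 + (m2 + m3))%N.

Lemma mx33_cols : mx33 A11 A12 A13 A21 A22 A23 A31 A32 A33 =
  row_mx (col_mx A11 (col_mx A21 A31))
    (row_mx (col_mx A12 (col_mx A22 A32)) (col_mx A13 (col_mx A23 A33))).
Proof. by rewrite /mx33 !col_row3. Qed.

Lemma xdet_mx33_last : m3 = n3 ->
  xdet (mx33 A11 A12 0 A21 A22 0 A31 A32 A33) = xdet (mx22 A11 A12 A21 A22) * xdet A33.
Proof.
move=> e3; rewrite /mx33 /mx22 xdet_colA.
have -> : col_mx (col_mx (row_mx A11 (row_mx A12 0)) (row_mx A21 (row_mx A22 0)))
      (row_mx A31 (row_mx A32 A33)) =
    row_mx (col_mx (col_mx A11 A21) A31) (row_mx (col_mx (col_mx A12 A22) A32)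
       (col_mx (0 : 'M_(m1 + m2, n3)) A33)).
  by rewrite !col_row3 col_mx0.
rewrite xdet_rowA -!block_mxEh !block_mxEv.
by rewrite xdet_lblock //; lia.
Qed.

Lemma xdet_mx33_first : m1 = (n1 + n2)%N ->
  xdet (mx33 A11 A12 0 A21 A22 A23 A31 A32 A33) =
  xdet (row_mx A11 A12) * xdet (col_mx A23 A33).
Proof.
move=> e1; have -> : xdet (mx33 A11 A12 0 A21 A22 A23 A31 A32 A33) =
    xdet (col_mx (row_mx (row_mx A11 A12) 0)
           (row_mx (row_mx (col_mx A21 A31) (col_mx A22 A32)) (col_mx A23 A33))).
  rewrite /mx33 -[in RHS]block_mxEv block_mxEh -[in RHS]block_mxEv block_mxEh.
  by rewrite -xdet_rowA !col_row3.
by rewrite xdet_lblock //; lia.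
Qed.

Lemma xdet_mx33_swapr : xdet (mx33 A11 A12 A13 A21 A22 A23 A31 A32 A33) =
  (-1) ^+ (m2 * m3) * xdet (mx33 A11 A12 A13 A31 A32 A33 A21 A22 A23).
Proof. exact/xdet_colCr/esym. Qed.

Lemma xdet_mx33_swapr1 : xdet (mx33 A11 A12 A13 A21 A22 A23 A31 A32 A33) =
  (-1) ^+ (m1 * m2) * xdet (mx33 A21 A22 A23 A11 A12 A13 A31 A32 A33).
Proof. exact/xdet_colCA/esym. Qed.

Lemma xdet_mx33_scaler c1 c2 c3 :
  xdet (mx33 (c1 *: A11) (c1 *: A12) (c1 *: A13) (c2 *: A21) (c2 *: A22) (c2 *: A23)
             (c3 *: A31) (c3 *: A32) (c3 *: A33)) =
  c1 ^+ m1 * c2 ^+ m2 * c3 ^+ m3 * xdet (mx33 A11 A12 A13 A21 A22 A23 A31 A32 A33).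
Proof.
rewrite {1}/mx33 -!scale_row_mx -!mul_scalar_mx xdet_col_mull //.
have -> (r : nat) (Y : 'M[R]_(m2, r)) (Z : 'M_(m3, r)) :
    col_mx (c2%:M *m Y) (c3%:M *m Z) =
    col_mx (row_mx c2%:M 0) (row_mx 0 c3%:M) *m col_mx Y Z.
  by rewrite mul_col_mx !mul_row_col !mul0mx addr0 add0r.
by rewrite xdet_col_mulr // xdet_ublock // !xdetE !det_scalar !mulrA.
Qed.

End BlockDet.

Section BlockDetCols.
Variables (R : comNzRingType) (m1 m2 m3 n1 n2 n3 : nat).
Variables (A11 : 'M[R]_(m1, n1)) (A12 : 'M[R]_(m1, n2)) (A13 : 'M[R]_(m1, n3)).
Variables (A21 : 'M[R]_(m2, n1)) (A22 : 'M[R]_(m2, n2)) (A23 : 'M[R]_(m2, n3)).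
Variables (A31 : 'M[R]_(m3, n1)) (A32 : 'M[R]_(m3, n2)) (A33 : 'M[R]_(m3, n3)).
Hypothesis e : (m1 + (m2 + m3) = n1 + (n2 + n3))%N.

Lemma xdet_mx33_swapc : xdet (mx33 A11 A12 A13 A21 A22 A23 A31 A32 A33) =
  (-1) ^+ (n2 * n3) * xdet (mx33 A11 A13 A12 A21 A23 A22 A31 A33 A32).
Proof. by rewrite !mx33_cols xdet_rowCr. Qed.

Lemma xdet_mx33_scalec c1 c2 c3 :
  xdet (mx33 (c1 *: A11) (c2 *: A12) (c3 *: A13) (c1 *: A21) (c2 *: A22) (c3 *: A23)
             (c1 *: A31) (c2 *: A32) (c3 *: A33)) =
  c1 ^+ n1 * c2 ^+ n2 * c3 ^+ n3 * xdet (mx33 A11 A12 A13 A21 A22 A23 A31 A32 A33).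
Proof.
rewrite !mx33_cols -!scale_col_mx -!mul_mx_scalar xdet_row_mull //.
by rewrite -mul_row_diag xdet_row_mulr // xdet_ublock // !xdetE !det_scalar; ring.
Qed.

Lemma xdet_mx33_add23 C :
  xdet (mx33 A11 A12 A13 (A21 + C *m A31) (A22 + C *m A32) (A23 + C *m A33)
             A31 A32 A33) =
  xdet (mx33 A11 A12 A13 A21 A22 A23 A31 A32 A33).
Proof.
rewrite /mx33 -!add_row_mx -!mul_mx_row.
set X := row_mx A11 _; set Y := row_mx A21 _; set Z := row_mx A31 _.
have -> : col_mx (Y + C *m Z) Z = col_mx (row_mx 1%:M C) (row_mx 0 1%:M) *m col_mx Y Z.
  by rewrite mul_col_mx !mul_row_col mul0mx !mul1mx add0r.
by rewrite xdet_col_mulr // xdet_ublock // !xdet1 !mul1r.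
Qed.

Lemma xdet_mx33_add32 C :
  xdet (mx33 A11 A12 A13 A21 A22 A23
             (A31 + C *m A21) (A32 + C *m A22) (A33 + C *m A23)) =
  xdet (mx33 A11 A12 A13 A21 A22 A23 A31 A32 A33).
Proof.
rewrite /mx33 -!add_row_mx -!mul_mx_row.
set X := row_mx A11 _; set Y := row_mx A21 _; set Z := row_mx A31 _.
have -> : col_mx Y (Z + C *m Y) = col_mx (row_mx 1%:M 0) (row_mx C 1%:M) *m col_mx Y Z.
  by rewrite mul_col_mx !mul_row_col mul0mx !mul1mx addr0 addrC.
by rewrite xdet_col_mulr // xdet_lblock // !xdet1 !mul1r.
Qed.

End BlockDetCols.

(** * Evaluation of the generating determinant *)

Lemma dbl_det_reduce (R : comNzRingType) m n d1 k1 (a : 'I_m -> R) (b : 'I_n -> R) x t c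
    (C : 'M_(d1, k1)) : (d1 + k1 = 1 + (m + n))%N ->
  C *m pw k1 a = c *: pw d1 a -> C *m pw k1 b = c *: pw d1 b ->
  dbl_det d1 k1 a b x t = xdet (col_mx
    (row_mx (pw d1 (pt x)) (row_mx ((t + c) *: pw d1 a) ((1 + c) *: pw d1 b)))
    (row_mx 0 (row_mx (pw k1 a) (pw k1 b)))).
Proof.
move=> e Ca Cb; rewrite /dbl_det -(xdet_col_addl _ _ C) //.
by rewrite !mul_mx_row mulmx0 Ca Cb !add_row_mx addr0 !scalerDl scale1r.
Qed.

Section LowDegree.
Variables (R : comNzRingType) (m n d1 N : nat) (a : 'I_m -> R) (b : 'I_n -> R) (x : R).
Let k1 := (N + m)%N.

(** This is the cofactor left when [dbl_det] is divided by (1 - t)^d, for d1 = d + 1. *)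
Definition low_det : R := xdet (col_mx
  (row_mx (pw d1 (pt x)) (row_mx 0 (pw d1 b)))
  (row_mx 0 (row_mx (pw k1 a) (pw k1 b)))).

(** In the lower rows, multiples of f replace the powers in degrees at least m. They
    vanish on A, so that the columns of A split off with the remaining m powers. *)
Lemma low_detE : (N + d1 = n + 1)%N ->
  low_det = (-1) ^+ (m * n + N * d1 + n) * vander a *
    xdet (col_mx (row_mx (ev N (rootpoly a) b) 0) (row_mx (pw d1 b) (pw d1 (pt x)))).
Proof.
move=> e; set f := rootpoly a.
have fm : f \is monic := rootpoly_monic a; have sf : size f = m.+1 := size_rootpoly a.
have d_basis : xdet (basis_mx N m f) = 1 by rewrite xdetE det_basis_mx.
rewrite /low_det -[LHS]mul1r -[X in X * _]d_basis -xdet_col_mulr ?/k1; try lia.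
rewrite !mul_mx_row mulmx0 !basis_mxE ?sf // ev_rootpoly0.
have -> : row_mx 0 (row_mx (col_mx 0 (pw m a)) (col_mx (ev N f b) (pw m b))) =
    col_mx (row_mx 0 (row_mx 0 (ev N f b))) (row_mx 0 (row_mx (pw m a) (pw m b)))
    :> 'M_(N + m, 1 + (m + n)).
  by rewrite col_row3 col_mx0.
rewrite -/(mx33 _ _ _ _ _ _ _ _ _) xdet_mx33_swapc; last by lia.
rewrite xdet_mx33_last //; last by lia.
rewrite /mx22 xdet_colC; last by lia.
have -> : xdet (col_mx (row_mx (0 : 'M_(N, 1)) (ev N f b))
                       (row_mx (pw d1 (pt x)) (pw d1 b))) =
    (-1) ^+ n * xdet (col_mx (row_mx (ev N f b) 0) (row_mx (pw d1 b) (pw d1 (pt x)))).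
  rewrite -[in LHS]block_mxEv block_mxEh [LHS]xdet_rowC; last by lia.
  by rewrite mul1n -block_mxEh block_mxEv.
rewrite xdetE -/(vander a) !exprD (mulnC d1).
by rewrite !mulrA mulrAC.
Qed.

End LowDegree.

Lemma low_det_map (R S : comNzRingType) (phi : {rmorphism R -> S}) m n d1 N
    (a : 'I_m -> R) (b : 'I_n -> R) x : (d1 + (N + m) = 1 + (m + n))%N ->
  low_det d1 N (phi \o a) (phi \o b) (phi x) = phi (low_det d1 N a b x).
Proof.
move=> e; rewrite /low_det -xdet_map // map_col_mx !map_row_mx !map_mx0 !map_pw.
by [].
Qed.

(** Subtracting t times the lower rows leaves (x^i, 0, (1 - t) b^i) in the upper
    rows. A common factor 1 - t of these rows appears once the column of x is multiplied
    by 1 - t too, which accounts for one factor. *)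
Lemma dbl_det_low (R : idomainType) m n d1 N (a : 'I_m -> R) (b : 'I_n -> R) x t :
  t != 1 -> (N + d1.+1 = n + 1)%N -> (d1 <= m)%N -> (d1 < n)%N ->
  dbl_det d1.+1 (N + m) a b x t = (1 - t) ^+ d1 * low_det d1.+1 N a b x.
Proof.
move=> t1 e dm dn; have [M ek] : exists M, (N + m = M + d1.+1)%N.
  by exists (N + m - d1.+1)%N; lia.
have e' : (d1.+1 + (N + m) = 1 + (m + n))%N by lia.
pose J : 'M[R]_(d1.+1, N + m) :=
  castmx (erefl, esym ek) (- t *: row_mx (0 : 'M_(d1.+1, M)) 1%:M).
have JE l (y : 'I_l -> R) : J *m pw (N + m) y = - t *: pw d1.+1 y.
  rewrite /J; move: (N + m)%N ek {J e'} => k ek; subst k.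
  by rewrite castmx_id -scalemxAl pw_shift.
rewrite (@dbl_det_reduce _ _ _ _ _ _ _ _ _ (- t) J) // addrN scale0r.
have t1' : 1 - t != 0 by rewrite subr_eq0 eq_sym.
(* Both sides are multiplied by 1 - t, absorbed on the left by the column of x. *)
apply: (mulfI t1'); rewrite [RHS]mulrA -exprS /low_det.
set W := row_mx 0 (row_mx (pw (N + m) a) _).
have detS r : xdet ((1 - t)%:M : 'M[R]_r) = (1 - t) ^+ r by rewrite xdetE det_scalar.
rewrite -(detS d1.+1) -xdet_col_mull ?e' //.
rewrite -[X in X * _]expr1 -detS mulrC /W !col_row3 -xdet_row_mull //.
rewrite mul_col_mx mul0mx -!col_row3; congr (xdet (col_mx _ _)).
by rewrite mul_mx_scalar !mul_mx_row mulmx0 !mul_scalar_mx.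
Qed.

Lemma xdet_null (R : idomainType) r s (A : 'M[R]_(r, s)) (v : 'rV_r) :
  r = s -> v != 0 -> v *m A = 0 -> xdet A = 0.
Proof.
move=> e v0 vA; subst s; rewrite xdetE; apply/eqP/det0P.
by exists v.
Qed.

(** The polynomial (X - x) f has degree m + 1, and so is a combination of the powers
    in either half. The corresponding combination of the upper rows minus that of the
    lower rows vanishes: the polynomial is 0 at x and on A, and at the points of B the
    two halves agree. *)
Lemma dbl_det_eq0 (R : idomainType) m n d1 k1 (a : 'I_m -> R) (b : 'I_n -> R) x t :
  (d1 + k1 = 1 + (m + n))%N -> (m + 1 < d1)%N -> (m + 1 < k1)%N ->
  dbl_det d1 k1 a b x t = 0.
Proof.
move=> e hd hk; pose h := ('X - x%:P) * rootpoly a.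
have sh : size h = m.+2.
  rewrite size_monicM ?monicXsubC ?monic_neq0 ?rootpoly_monic //.
  by rewrite size_XsubC size_rootpoly.
have hm : h \is monic by rewrite monicMl ?rootpoly_monic ?monicXsubC.
pose c k : 'rV[R]_k := coef_mx k (pt h).
have cE k M (y : 'I_M -> R) : (m + 1 < k)%N -> c k *m pw k y = \row_j h.[y j].
  move=> hk'; rewrite coef_mx_pw ?sh; last by move=> _; lia.
  by apply/matrixP=> i j; rewrite !mxE.
apply: (xdet_null (v := row_mx (c d1) (- c k1))) => //.
  apply/eqP => /(congr1 (@lsubmx _ _ _ _)); rewrite row_mxKl linear0.
  have hi : (d1 - m.+2 < d1)%N by lia.
  move=> /matrixP /(_ ord0 (Ordinal hi)) /eqP; rewrite !mxE /=.
  rewrite (_ : (_ - _)%N = (size h).-1); last by rewrite sh /=; lia.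
  by rewrite -lead_coefE (monicP hm) oner_eq0.
rewrite mul_row_col !mul_mx_row mulmx0 -scalemxAr !mulNmx !cE // !add_row_mx.
rewrite addr0 addrN.
have -> : \row_j h.[pt x j] = 0 :> 'rV_1.
  by apply/matrixP=> i j; rewrite !mxE hornerM hornerXsubC subrr mul0r.
have -> : \row_j h.[a j] = 0 :> 'rV_m.
  by apply/matrixP=> i j; rewrite !mxE hornerM rootpoly0 mulr0.
by rewrite scaler0 oppr0 addr0 !row_mx0.
Qed.

Section MiddleDegree.
Variables (R : comNzRingType) (m n N : nat) (a : 'I_m -> R) (b : 'I_n -> R) (x t : R).
Let f := rootpoly a.

(** Of the powers in degrees n - 1, ..., 0, those in degrees above m are replaced by
    multiples of (X - x) f, which vanish at x and on A. Subtracting the lower rows from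
    the last m + 1 upper ones clears B there; these rows then split off with the columns
    of x and A, and in them f separates x from A. *)
Lemma dbl_det_middle : (n = N + (1 + m))%N ->
  dbl_det n (1 + m) a b x t =
  (-1) ^+ (N * (1 + m)) * (f.[x] * ((t - 1) ^+ m * vander a) * vander b).
Proof.
move=> e; have fm : f \is monic := rootpoly_monic a.
have sf : size f = m.+1 := size_rootpoly a.
pose h := f * ('X - x%:P).
have hm : h \is monic by rewrite monicMl ?monicXsubC.
have sh : size h = (1 + m).+1.
  by rewrite size_monicM ?monic_neq0 ?monicXsubC // size_XsubC sf addn2.
have hx : ev N h (pt x) = 0.
  by apply/matrixP=> i j; rewrite !mxE hornerM hornerXsubC subrr mulr0 mul0r.
have ha : ev N h a = 0.
  by apply/matrixP=> i j; rewrite !mxE hornerM rootpoly0 !mul0r.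
have d_h : xdet (basis_mx N (1 + m) h) = 1 by rewrite xdetE det_basis_mx.
have d_f : xdet (basis_mx 1 m f) = 1 by rewrite xdetE det_basis_mx.
have e' : (n + (1 + m) = 1 + (m + n))%N by lia.
rewrite /dbl_det; subst n.
rewrite -[LHS]mul1r -[X in X * _]d_h -xdet_col_mull; try lia.
rewrite !mul_mx_row -scalemxAr !basis_mxE ?sh // hx ha scale_col_mx scaler0 -!col_row3.
rewrite -xdet_colA.
have -> : xdet (col_mx (row_mx 0 (row_mx 0 (ev N h b))) (col_mx
      (row_mx (pw (1 + m) (pt x)) (row_mx (t *: pw (1 + m) a) (pw (1 + m) b)))
      (row_mx 0 (row_mx (pw (1 + m) a) (pw (1 + m) b))))) =
    xdet (mx33 0 0 (ev N h b) (pw (1 + m) (pt x)) ((t - 1) *: pw (1 + m) a) 0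
      0 (pw (1 + m) a) (pw (1 + m) b)).
  rewrite -[RHS](@xdet_mx33_add23 _ _ _ _ _ _ _ _ _ _ _ _ _ _ _ _ _ 1%:M); last by lia.
  by rewrite !mul1mx addr0 add0r scalerBl scale1r subrK.
rewrite xdet_mx33_swapr1; last by lia.
rewrite xdet_mx33_first //; try lia.
congr (_ * (_ * _)).
  rewrite -[LHS]mul1r -[X in X * _]d_f -xdet_mul // mul_mx_row -scalemxAr !basis_mxE ?sf //.
  rewrite ev_rootpoly0 scale_col_mx scaler0 -block_mxEh block_mxEv xdet_lblock //.
  rewrite -mul_scalar_mx xdet_mul // !xdetE det_scalar det_mx11 mxE expr0 mulr1.
  by [].
by rewrite -basis_mxE ?sh // xdet_mul // d_h mul1r xdetE.
Qed.
End MiddleDegree.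

Lemma xdet_row_linear (R : comNzRingType) r s c (X Y : 'cV[R]_r) (Z : 'M_(r, s)) :
  r = (1 + s)%N ->
  xdet (row_mx (c *: X - Y) Z) = c * xdet (row_mx X Z) - xdet (row_mx Y Z).
Proof.
move=> e; subst r; rewrite !xdetE -!(det_tr (row_mx _ _)) !tr_row_mx -mulN1r.
apply: (determinant_multilinear (i0 := lshift s ord0)).
- by apply/rowP=> j; rewrite !mxE (unsplitK (inl _)) !mxE mulN1r.
- apply/matrixP=> i j; rewrite !mxE; case: splitP => i' //= ii'.
  by move: ii'; rewrite ord1.
- apply/matrixP=> i j; rewrite !mxE; case: splitP => i' //= ii'.
  by move: ii'; rewrite ord1.
Qed.

Section HighDegree.
Variables (R : comNzRingType) (l k1 : nat).
Local Notation hi y := (ev l 'X^k1 y).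
Local Notation lo y := (pw k1 y).

(** The powers in degrees at least k1 are separated from those that also occur in the
    lower half of the generating determinant. *)
Lemma pw_split M (y : 'I_M -> R) : pw (l + k1) y = col_mx (hi y) (lo y).
Proof.
apply/matrixP=> i j; rewrite !mxE; rewrite hornerC mul1r.
case: splitP => i' ->; rewrite !mxE ?hornerC ?mul1r.
  by rewrite hornerXn -exprD; congr (_ ^+ _); have := ltn_ord i'; lia.
by congr (_ ^+ _); lia.
Qed.

(** The coefficient of t in the last factor of [dbl_det_high]; up to sign, the
    constant term is the same expression with a and b exchanged. *)
Definition high_det m n (a : 'I_m -> R) (b : 'I_n -> R) x : R :=
  xdet (mx33 (hi (pt x)) (hi a) (hi b) (lo (pt x)) (lo a) 0 0 0 (lo b)).

(** Adding the third block of rows to the second makes the first two blocks the rows of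
    the powers in degrees below l + k1 at x, a and b. Those in degrees at least m are
    replaced by multiples of f, which vanish on a. *)
Lemma high_detE m n N (a : 'I_m -> R) (b : 'I_n -> R) x :
  (l + k1 = N + m)%N -> (N + k1 = n + 1)%N ->
  high_det a b x = (-1) ^+ (m * n + m * k1 + n) * vander a * (rootpoly a).[x] *
    xdet (col_mx (row_mx (ev N (rootpoly a) b) (pw N (pt x))) (row_mx (lo b) 0)).
Proof.
move=> ed en; set f := rootpoly a.
have fm : f \is monic := rootpoly_monic a; have sf : size f = m.+1 := size_rootpoly a.
have d_f : xdet (basis_mx N m f) = 1 by rewrite xdetE det_basis_mx.
rewrite /high_det -(@xdet_mx33_add23 _ _ _ _ _ _ _ _ _ _ _ _ _ _ _ _ _ 1%:M); last by lia.
rewrite !mul1mx !addr0 add0r /mx33 xdet_colA !col_row3 -!pw_split -col_row3.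
move: (l + k1)%N ed => d ed; subst d.
rewrite -[LHS]mul1r -[X in X * _]d_f -xdet_col_mull; try lia.
rewrite !mul_mx_row !basis_mxE ?sf // ev_rootpoly0 -!col_row3 -xdet_colA.
rewrite -/(mx33 _ _ _ _ _ _ _ _ _) xdet_mx33_swapc; last by lia.
rewrite xdet_mx33_swapr; last by lia.
rewrite xdet_mx33_last //; try lia.
rewrite /mx22 -block_mxEv block_mxEh.
have -> : ev N f (pt x) = pw N (pt x) *m f.[x]%:M.
  by rewrite mul_mx_scalar; apply/matrixP=> i j; rewrite !mxE hornerC mul1r.
rewrite xdet_rowC; last by lia.
have -> : col_mx (pw N (pt x) *m f.[x]%:M) (0 : 'M_(k1, 1)) =
    col_mx (pw N (pt x)) 0 *m f.[x]%:M by rewrite mul_col_mx mul0mx.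
rewrite xdet_row_mulr //; try lia.
rewrite [xdet f.[x]%:M]xdetE det_scalar1 -block_mxEh block_mxEv mul1n.
rewrite [xdet (pw m a)]xdetE -/(vander a).
rewrite !exprD -!mulrA; congr (_ * (_ * (_ * _))).
by rewrite mulrA mulrC [_ * f.[x]]mulrC.
Qed.

Lemma high_det_swap m n (a : 'I_m -> R) (b : 'I_n -> R) x :
  (l + (k1 + k1) = 1 + (m + n))%N ->
  xdet (mx33 (hi (pt x)) (hi a) (hi b) 0 (lo a) 0 (lo (pt x)) 0 (lo b)) =
  (-1) ^+ (k1 + m * n) * high_det b a x.
Proof.
move=> e; rewrite xdet_mx33_swapr; last by lia.
rewrite xdet_mx33_swapc; last by lia.
rewrite mulrA -exprD /high_det; congr (_ * _).
by rewrite -[LHS]signr_odd -[RHS]signr_odd !oddD oddM andbb.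
Qed.

End HighDegree.

(** Multiply by t - 1 the upper rows in degrees above k1; replace each other upper row
    r, and the lower row s of the same degree, by t (r - s) and t s - r. Then the
    columns of A are divisible by t (t - 1), those of B by t - 1, and the quotient
    depends on t in the column of x only, where it is affine in t. *)
Lemma dbl_det_high (R : idomainType) l k1 m n (a : 'I_m -> R) (b : 'I_n -> R) x t :
  t != 0 -> t != 1 -> (l + k1.+1 + k1.+1 = 1 + (m + n))%N -> (k1 < m)%N ->
  dbl_det (l + k1.+1) k1.+1 a b x t = t ^+ (m - k1.+1) * (t - 1) ^+ k1 *
   (t * high_det l k1.+1 a b x - (-1) ^+ (k1.+1 + m * n) * high_det l k1.+1 b a x).
Proof.
set k := k1.+1 => t0 t1 e km.
have e' : (l + (k + k) = 1 + (m + n))%N by lia.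
have t1' : t - 1 != 0 by rewrite subr_eq0.
pose hi M (y : 'I_M -> R) := ev l 'X^k y; pose lo M (y : 'I_M -> R) := pw k y.
(* Subtracting the lower rows clears B from the upper rows in degrees below k. *)
have D1 : dbl_det (l + k) k a b x t =
    xdet (mx33 (hi _ (pt x)) (t *: hi _ a) (hi _ b) (lo _ (pt x)) ((t - 1) *: lo _ a) 0
               0 (lo _ a) (lo _ b)).
  rewrite /dbl_det !pw_split scale_col_mx -col_row3 -xdet_colA.
  rewrite -[RHS](@xdet_mx33_add23 _ _ _ _ _ _ _ _ _ _ _ _ _ _ _ _ _ 1%:M); last by lia.
  by rewrite !mul1mx addr0 add0r scalerBl scale1r subrK.
(* The lower rows, times t - 1, minus the rows just obtained no longer involve A. *)
have D2 : (t - 1) ^+ k * dbl_det (l + k) k a b x t =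
    xdet (mx33 (hi _ (pt x)) (t *: hi _ a) (hi _ b) (lo _ (pt x)) ((t - 1) *: lo _ a) 0
               (- lo _ (pt x)) 0 ((t - 1) *: lo _ b)).
  rewrite -[RHS](@xdet_mx33_add32 _ _ _ _ _ _ _ _ _ _ _ _ _ _ _ _ _ 1%:M); last by lia.
  rewrite !mul1mx addNr addr0 add0r D1.
  have := @xdet_mx33_scaler _ _ _ _ _ _ _ (hi _ (pt x)) (t *: hi _ a) (hi _ b)
    (lo _ (pt x)) ((t - 1) *: lo _ a) 0 0 (lo _ a) (lo _ b) (esym e') 1 1 (t - 1).
  by rewrite !scale1r !scaler0 !expr1n !mul1r => ->.
(* Comparison of the factors of the rows, on the left, and of the columns. *)
have D3 : (t - 1) ^+ l * t ^+ k * ((t - 1) ^+ k * dbl_det (l + k) k a b x t) =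
    (t * (t - 1)) ^+ m * (t - 1) ^+ n *
    xdet (mx33 ((t - 1) *: hi _ (pt x)) (hi _ a) (hi _ b) (t *: lo _ (pt x)) (lo _ a) 0
               (- lo _ (pt x)) 0 (lo _ b)).
  rewrite D2.
  have := @xdet_mx33_scaler _ _ _ _ _ _ _ (hi _ (pt x)) (t *: hi _ a) (hi _ b)
    (lo _ (pt x)) ((t - 1) *: lo _ a) 0 (- lo _ (pt x)) 0 ((t - 1) *: lo _ b) (esym e')
    (t - 1) t 1.
  rewrite expr1n mulr1 => <-.
  have := @xdet_mx33_scalec _ _ _ _ _ _ _ ((t - 1) *: hi _ (pt x)) (hi _ a) (hi _ b)
    (t *: lo _ (pt x)) (lo _ a) 0 (- lo _ (pt x)) 0 (lo _ b) e' 1 (t * (t - 1)) (t - 1).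
  rewrite expr1n mul1r => <-.
  by rewrite !scale1r !scaler0 !scalerA [(t - 1) * t]mulrC.
move: D3; rewrite mx33_cols.
have -> : col_mx ((t - 1) *: hi _ (pt x)) (col_mx (t *: lo _ (pt x)) (- lo _ (pt x))) =
    t *: col_mx (hi _ (pt x)) (col_mx (lo _ (pt x)) 0) -
    col_mx (hi _ (pt x)) (col_mx 0 (lo _ (pt x))).
  rewrite !scale_col_mx !opp_col_mx !add_col_mx scalerBl scale1r scaler0 oppr0 addr0.
  by rewrite add0r.
rewrite xdet_row_linear //; rewrite -!mx33_cols (high_det_swap _ _ _ e').
rewrite -/(high_det l k a b x); set V := t * high_det _ _ _ _ _ - _ => D3.
have c0 : (t - 1) ^+ l * t ^+ k * (t - 1) ^+ k != 0.
  by rewrite !mulf_neq0 ?expf_neq0.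
have tm : t ^+ m = t ^+ k * t ^+ (m - k) by rewrite -exprD; congr (_ ^+ _); lia.
have tn : (t - 1) ^+ m * (t - 1) ^+ n = (t - 1) ^+ l * (t - 1) ^+ k * (t - 1) ^+ k1.
  by rewrite -!exprD; congr (_ ^+ _); lia.
apply: (mulfI c0); rewrite -[LHS]mulrA D3 exprMn -[_ * _ ^+ n]mulrA tm tn.
clearbody V; clear D1 D2 D3 c0 tm tn.
move: (t ^+ k) (t ^+ (m - k)) ((t - 1) ^+ l) ((t - 1) ^+ k) ((t - 1) ^+ k1) V.
move=> u1 u2 u3 u4 u5 u6 /=; ring.
Qed.

(** * The double sums *)

Lemma coef_1subXn (R : comNzRingType) d p :
  ((1 - 'X : {poly R}) ^+ d)`_p = (-1) ^+ p * 'C(d, p)%:R.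
Proof.
elim: d p => [|d IHd] p.
  by rewrite expr0 coef1 bin0n; case: p => [|p]; rewrite ?mulr1 ?mulr0.
rewrite exprS mulrBl mul1r coefB coefXM IHd; case: p => [|p] /=.
  by rewrite !bin0 subr0.
by rewrite IHd binS natrD mulrDr exprS; ring.
Qed.

Lemma sign_eq (R : nzRingType) x y : odd x = odd y -> (-1) ^+ x = (-1) ^+ y :> R.
Proof. by move=> e; rewrite -signr_odd e signr_odd. Qed.

(** Exchanging f and g exchanges the two blocks of rows. *)
Lemma SresG_swap (R : comNzRingType) m n j (f g : {poly R}) :
  SresG m n j f g = (-1) ^+ ((n - j) * (m - j)) * SresF n m j g f.
Proof.
rewrite /SresG /SresF -!xdetE; set M := sres_mx _ _ _ _; set M' := sres_mx _ _ _ _.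
rewrite -[M]vsubmxK xdet_colC //; congr (_ * _).
rewrite -(xdet_cast (erefl, addnC (n - j)%N (m - j)%N) (col_mx _ _)); congr xdet.
apply/matrixP=> r c; rewrite castmxE /= cast_ord_id [RHS]mxE.
case: (split_ordP r) => i ->; rewrite ?col_mxEu ?col_mxEd [LHS]mxE [LHS]mxE;
  rewrite ?(unsplitK (inl _)) ?(unsplitK (inr _)) /=.
  by rewrite (addnC (n - j)%N).
by rewrite (addnC (n - j)%N).
Qed.

Lemma high_det_map (R S : comNzRingType) (phi : {rmorphism R -> S}) l k1 m n
    (a : 'I_m -> R) (b : 'I_n -> R) x : (l + (k1 + k1) = 1 + (m + n))%N ->
  high_det l k1 (phi \o a) (phi \o b) (phi x) = phi (high_det l k1 a b x).
Proof.
move=> e; rewrite /high_det -xdet_map //.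
by rewrite !map_col_mx !map_row_mx !map_mx0 !map_pw !map_ev map_polyXn.
Qed.

Lemma rootpoly_polyX (R : comNzRingType) k (y : 'I_k -> R) :
  (rootpoly (polyC \o y)).['X] = rootpoly y.
Proof. by rewrite -map_rootpoly -[LHS]/(rootpoly y \Po 'X) comp_polyXr. Qed.

(** For k1 = k + 1 what [high_detE] leaves is the determinant of [xdet_sresF]. *)
Lemma high_det_SresF (R : comNzRingType) m n l k (a : 'I_m -> R) (b : 'I_n -> R) :
  (k <= m)%N -> (k < n)%N -> (l + k.+1 + k = m + n)%N ->
  high_det l k.+1 (polyC \o a) (polyC \o b) 'X =
  (-1) ^+ (m * n + m * k.+1 + n + ((n - k) * (m - k) + k.+1)) *
    (vander a * vander b)%:P * (SresF m n k (rootpoly a) (rootpoly b) * rootpoly a).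
Proof.
move=> km kn e; rewrite (@high_detE _ _ _ _ _ (n - k)); try lia.
have -> : pw (n - k) (pt 'X) = \col_i 'X^(n - k - i.+1) :> 'M[{poly R}]_(_, 1).
  by apply/matrixP=> i j; rewrite !mxE hornerC mul1r.
rewrite rootpoly_polyX -map_rootpoly.
have := @xdet_sresF _ m n k (rootpoly a) _ km kn b _ erefl (fun i => 'X^(n - k - i.+1)).
rewrite size_rootpoly => /(_ (ltnSn m)) ->; rewrite -/(SresF _ _ _ _ _).
rewrite !vander_map [in RHS]exprD polyCM.
have reorder (s1 s2 u v f S : {poly R}) :
  s1 * u * f * (s2 * v * S) = s1 * s2 * (u * v) * (S * f) by ring.
exact: reorder.
Qed.

Lemma polyX_neq1 (R : nzRingType) : ('X : {poly R}) != 1.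
Proof.
by apply/eqP => /(congr1 (fun h : {poly R} => size h)); rewrite size_polyX size_poly1.
Qed.

Section Assembly.
Variables (K : fieldType) (m n : nat) (a : 'I_m -> K) (b : 'I_n -> K).
Hypotheses (a_inj : injective a) (b_inj : injective b).
Let f := rootpoly a.
Let g := rootpoly b.
Let aP := polyC \o a.
Let bP := polyC \o b.
Let VV : {poly K} := (vander a * vander b)%:P.

Let VV_neq0 : VV != 0.
Proof. by rewrite polyC_eq0 mulf_neq0 ?vander_neq0. Qed.

Let VVE : VV = vander aP * vander bP.
Proof. by rewrite !vander_map -polyCM. Qed.

Lemma gen_det_low d : (d <= m)%N -> (d < n)%N ->
  gen_det a b d.+1 (n - d + m) =
  (1 - 'X) ^+ d * ((-1) ^+ (d * m) * VV * Sres m n d f g)%:P.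
Proof.
move=> dm dn; rewrite /gen_det dbl_det_low; try lia; last first.
  exact: polyX_neq1.
rewrite low_det_map; last by lia.
congr (_ * _%:P); rewrite low_detE; last by lia.
rewrite -map_rootpoly (@xdet_Sres _ m n d f g dm dn b) ?size_rootpoly // VVE -/aP -/bP.
have [N1 en] : exists N1, n = (d + N1)%N by exists (n - d)%N; lia.
have [N2 em] : exists N2, m = (d + N2)%N by exists (m - d)%N; lia.
have -> : (-1) ^+ (d * m) = (-1) ^+ (m * n + (n - d) * d.+1 + n) *
    (-1) ^+ ((n - d) * (m - d) + d) :> {poly K}.
  rewrite -exprD; apply: sign_eq.
  have -> : (n - d = N1)%N by lia.
  have -> : (m - d = N2)%N by lia.
  rewrite em en -addn1 !(oddD, oddM).
  by case: (odd d); case: (odd N1); case: (odd N2).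
rewrite -!mulrA; congr (_ * _).
by rewrite mulrCA; congr (_ * _); rewrite mulrCA.
Qed.

(** The coefficient of t^p in (1 - t)^d is (-1)^p binomial(d, p). *)
Lemma Sylv_low p q (d := (p + q)%N) : (d <= m)%N -> (d < n)%N ->
  Sylv a b p q = (-1) ^+ (p * (m - d)) * 'C(d, p)%:R * Sres m n d f g.
Proof.
move=> dm dn; apply: (mulfI VV_neq0).
have := @coef_gen_det _ _ _ _ _ a_inj b_inj p q d.+1 (n - d + m).
rewrite gen_det_low // coefMC coef_1subXn => /(_ ltac:(lia) ltac:(lia) ltac:(lia)) E.
have /(congr1 ( *%R ((-1) ^+ (q * (m - p))))) := E.
rewrite -!mulrA signrMK => <-.
have [N2 em] : exists N2, m = (d + N2)%N by exists (m - d)%N; lia.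
have -> : (-1) ^+ (p * (m - d)) =
    (-1) ^+ (q * (m - p)) * (-1) ^+ p * (-1) ^+ (d * m) :> {poly K}.
  rewrite -!exprD; apply: sign_eq; have -> : (m - d = N2)%N by lia.
  have -> : (m - p = q + N2)%N by lia.
  rewrite em /d !(oddD, oddM).
  by case: (odd p); case: (odd q); case: (odd N2).
have reorder (s1 s2 s3 c v S : {poly K}) :
    s1 * (s2 * (c * (s3 * (v * S)))) = v * (s1 * s2 * s3 * (c * S)) by ring.
exact: reorder.
Qed.

Lemma Sylv_zero p q (d := (p + q)%N) : (p <= m)%N -> (m < d)%N -> (d < n - 1)%N ->
  Sylv a b p q = 0.
Proof.
move=> pm md dn; apply: (mulfI VV_neq0); rewrite mulr0.
have e : (d.+1 + (m + n - d) = 1 + (m + n))%N by lia.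
have := coef_gen_det a_inj b_inj pm (erefl (1 + (p + q))%N) e.
rewrite /gen_det dbl_det_eq0 ?coef0; try lia.
by move=> /esym/eqP; rewrite -mulrA mulf_eq0 signr_eq0 => /eqP.
Qed.

Lemma subX1_exp k : ('X - 1 : {poly {poly K}}) ^+ k = ((-1) ^+ k)%:P * (1 - 'X) ^+ k.
Proof. by rewrite -opprB [LHS]exprNn polyC_exp polyCN. Qed.

(** The factor (t - 1)^m of the generating determinant gives binomial(m, p). *)
Lemma Sylv_middle p q (d := (p + q)%N) : (p <= m)%N -> (m < d)%N -> d = (n - 1)%N ->
  Sylv a b p q = (-1) ^+ ((m + q) * (p + 1)) * 'C(m, p)%:R * f.
Proof.
move=> pm md dn; apply: (mulfI VV_neq0).
have e : (n + (1 + m) = 1 + (m + n))%N by lia.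
have en : (n = (n - m.+1) + (1 + m))%N by lia.
have ed : n = (1 + (p + q))%N by rewrite -/d; lia.
have := coef_gen_det a_inj b_inj pm ed e.
rewrite /gen_det (dbl_det_middle _ _ _ _ en) subX1_exp !vander_map.
rewrite -map_rootpoly horner_map rootpoly_polyX -/VV.
have -> : (-1) ^+ ((n - m.+1) * (1 + m)) * (f%:P * (((-1) ^+ m)%:P * (1 - 'X) ^+ m *
    (vander a)%:P%:P) * (vander b)%:P%:P) =
    (1 - 'X) ^+ m * ((-1) ^+ ((n - m.+1) * (1 + m) + m) * f * VV)%:P :> {poly {poly K}}.
  rewrite /VV exprD !polyCM !polyC_exp polyCN polyC1.
  have reorder (s1 s2 s3 h u v : {poly {poly K}}) :
    s1 * (h * (s2 * s3 * u) * v) = s3 * (s1 * s2 * h * (u * v)) by ring.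
  exact: reorder.
rewrite coefMC coef_1subXn => E.
have /(congr1 ( *%R ((-1) ^+ (q * (m - p))))) := E.
rewrite -!mulrA signrMK => <-.
have -> : (-1) ^+ ((m + q) * (p + 1)) = (-1) ^+ (q * (m - p)) * (-1) ^+ p *
    (-1) ^+ ((n - m.+1) * (1 + m) + m) :> {poly K}.
  rewrite -!exprD; apply: sign_eq.
  have [r em] : exists r, m = (p + r)%N by exists (m - p)%N; lia.
  have [N eq] : exists N, q = (r + N)%N by exists (q - r)%N; lia.
  have -> : (n - m.+1 = N)%N by lia.
  have -> : (m - p = r)%N by lia.
  rewrite eq em !(oddD, oddM) /=.
  by case: (odd p); case: (odd r); case: (odd N).
have reorder (s1 s2 s3 c v h : {poly K}) :
    s1 * (s2 * (c * (s3 * (h * v)))) = v * (s1 * s2 * s3 * (c * h)) by ring.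
exact: reorder.
Qed.

Lemma coef_Xn_subX1 (c : {poly K}) s k p :
  ('X^s * ('X - 1) ^+ k * c%:P)`_p =
  if (p < s)%N then 0 else (-1) ^+ (k + (p - s)) * 'C(k, p - s)%:R * c.
Proof.
rewrite -mulrA coefXnM; case: ifP => // _.
by rewrite coefMC subX1_exp coefCM coef_1subXn exprD mulrA.
Qed.

(** In t^(m-k-1) (t - 1)^k (t U - U') the coefficient of t^p takes binomial(k, m - p)
    from U, which carries F_k f, and binomial(k, n - q) from U', which carries G_k g.
    The first one vanishes together with the coefficient when p < m - k. *)
Lemma Sylv_high p q (d := (p + q)%N) (k := (m + n - d - 1)%N) :
  (0 < m)%N -> (p <= m)%N -> (q <= n)%N -> (m <= n)%N -> (n <= d)%N -> (d <= m + n - 1)%N ->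
  Sylv a b p q = (-1) ^+ (q * (m - p) + n * (d - m) + (d + n - q - 1)) *
    ('C(k, m - p)%:R * SresF m n k f g * f - 'C(k, n - q)%:R * SresG m n k f g * g).
Proof.
move=> m_gt0 pm qn mn nd dmn; apply: (mulfI VV_neq0).
have km : (k < m)%N by lia.
have e : (d.+1 + k.+1 = 1 + (m + n))%N by lia.
have := coef_gen_det a_inj b_inj pm (erefl (1 + (p + q))%N) e.
have [l el] : exists l, (1 + (p + q) = l + k.+1)%N by exists (d - k)%N; lia.
have e2 : (l + (k.+1 + k.+1) = 1 + (m + n))%N by lia.
rewrite /gen_det el dbl_det_high //; last by lia.
- rewrite high_det_map // high_det_map; last by lia.
  rewrite high_det_SresF; try lia.
  rewrite high_det_SresF; try lia.
  rewrite -/f -/g (mulrC (vander b)) -/VV.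
  set w : {poly K} := (-1) ^+ (n * k.+1 + m.+1).
  set F := SresF m n k f g; set F' := SresF n m k g f; set G := SresG m n k f g.
  have [r em] : exists r, m = (p + r)%N by exists (m - p)%N; lia.
  have [s en] : exists s, n = (q + s)%N by exists (n - q)%N; lia.
  have [u eq] : exists u, q = (r + u)%N by exists (q - r)%N; lia.
  have ek : k.+1 = (r + s)%N by lia.
  have -> : 'X^(m - k.+1) * ('X - 1) ^+ k * ('X *
      ((-1) ^+ (m * n + m * k.+1 + n + ((n - k) * (m - k) + k.+1)) * VV * (F * f))%:P -
      (-1) ^+ (k.+1 + m * n) *
      ((-1) ^+ (n * m + n * k.+1 + m + ((m - k) * (n - k) + k.+1)) * VV * (F' * g))%:P) =
      'X^(m - k) * ('X - 1) ^+ k * (w * VV * (F * f))%:P +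
      'X^(m - k.+1) * ('X - 1) ^+ k * (w * VV * (G * g))%:P :> {poly {poly K}}.
    have [v mv] : exists v, m.+1 = (s + v + r)%N by exists (m.+1 - (s + r))%N; lia.
    have nk : (n - k = u.+1)%N by lia.
    have mk : (m - k = v)%N by lia.
    have oddm : odd m = ~~ odd (s + v + r) by rewrite -mv /= negbK.
    have -> : F' = (-1) ^+ ((n - k) * (m - k)) * G by rewrite /G SresG_swap signrMK.
    have -> : (-1) ^+ (m * n + m * k.+1 + n + ((n - k) * (m - k) + k.+1)) = w.
      apply: sign_eq; rewrite nk mk ek en eq !(oddD, oddM, oddS) oddm !(oddD, oddS).
      by case: (odd v); case: (odd r); case: (odd s); case: (odd u).
    have -> : (-1) ^+ (n * m + n * k.+1 + m + ((m - k) * (n - k) + k.+1)) * VV *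
        ((-1) ^+ ((n - k) * (m - k)) * G * g) =
        (-1) ^+ (k.+1 + m * n) * - (w * VV * (G * g)).
      have sgn : (-1) ^+ (n * m + n * k.+1 + m + ((m - k) * (n - k) + k.+1)) *
          (-1) ^+ ((n - k) * (m - k)) = (-1) ^+ (k.+1 + m * n) * - w :> {poly K}.
        rewrite /w -[- _ ^+ _]mulN1r -exprS -!exprD; apply: sign_eq.
        rewrite nk mk ek en eq !(oddD, oddM, oddS) oddm !(oddD, oddS).
        by case: (odd v); case: (odd r); case: (odd s); case: (odd u).
      have shuffle (x1 x2 x3 x4 x5 : {poly K}) : x1 * x2 * (x3 * x4 * x5) =
        x1 * x3 * (x2 * (x4 * x5)) by ring.
      by rewrite shuffle sgn; ring.
    rewrite [(_ * - _)%:P]polyCM polyC_exp polyCN polyC1 signrMK polyCN opprK.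
    have -> : (m - k = (m - k.+1).+1)%N by lia.
    by rewrite mulrDr exprSr mulrA [_ * _ ^+ k * 'X]mulrAC.
  rewrite coefD !coef_Xn_subX1 (_ : (p < m - k.+1)%N = false); last by lia.
  have -> : (p - (m - k.+1) = s)%N by lia.
  have -> : (n - q = s)%N by lia.
  have -> : (m - p = r)%N by lia.
  set sg := (q * r + n * (d - m) + (d + n - q - 1))%N.
  (* The exponents are compared through sg + 1, which involves no subtraction. *)
  have sgE : sg.+1 = (q * r + n * u + (p + n))%N.
    rewrite /sg (_ : (d - m = u)%N); last by rewrite /d; lia.
    by rewrite -addnS; congr (_ + _)%N; rewrite /d; lia.
  have sign1 : (-1) ^+ (k + s) * w = (-1) ^+ (q * r) * - (-1) ^+ sg :> {poly K}.
    rewrite -[- _ ^+ sg]mulN1r -exprS sgE -!exprD; apply: sign_eq.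
    have -> : odd (k + s + (n * k.+1 + m.+1)) = odd (k.+1 + s + (n * k.+1 + m)).
      by rewrite !addnS !addSn.
    rewrite ek em en eq !(oddD, oddM).
    by case: (odd p); case: (odd r); case: (odd s); case: (odd u).
  move=> E; have {E} := congr1 ( *%R ((-1) ^+ (q * r))) E.
  rewrite -[_ * VV * Sylv _ _ _ _]mulrA signrMK => <-.
  have -> : (if (p < m - k)%N then 0
       else (-1) ^+ (k + (p - (m - k))) * 'C(k, p - (m - k))%:R * (w * VV * (F * f))) =
     (-1) ^+ (q * r) * (-1) ^+ sg * 'C(k, r)%:R * (VV * (F * f)).
    case: ifP => pk; first by rewrite bin_small ?mulr0 ?mul0r //; lia.
    have -> : (p - (m - k) = k - r)%N by lia.
    rewrite bin_sub; last by lia.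
    have sign2 : (-1) ^+ (k + (k - r)) * w = (-1) ^+ (q * r) * (-1) ^+ sg :> {poly K}.
      have -> : (-1) ^+ (k + (k - r)) = - (-1) ^+ (k + s) :> {poly K}.
        rewrite -[- _ ^+ (k + s)]mulN1r -exprS; apply: sign_eq; rewrite -addnS;
         have -> : (s.+1 = (k - r).+2)%N by lia.
        by rewrite addnS addnS /= negbK.
      by rewrite mulNr sign1 mulrN opprK.
    have reorder (s1 s2 c v h : {poly K}) : s1 * c * (s2 * v * h) = s1 * s2 * c * (v * h).
      by ring.
    by rewrite reorder sign2.
  have reorder (s1 s2 s3 s4 c1 c2 v F1 G1 f1 g1 : {poly K}) : s1 * s2 = s3 * - s4 ->
      s3 * (s3 * s4 * c1 * (v * (F1 * f1)) + s1 * c2 * (s2 * v * (G1 * g1))) =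
      s3 * s3 * (v * (s4 * (c1 * F1 * f1 - c2 * G1 * g1))).
    move=> h; have -> : s1 * c2 * (s2 * v * (G1 * g1)) = s1 * s2 * (c2 * v * (G1 * g1)).
      by ring.
    by rewrite h; ring.
  rewrite (reorder _ _ _ _ _ _ _ _ _ _ _ sign1) -expr2 sqrr_sign mul1r.
  reflexivity.
- by rewrite polyX_eq0.
exact: polyX_neq1.
Qed.

End Assembly.

Lemma Sylv_full (K : fieldType) m n (a : 'I_m -> K) (b : 'I_n -> K) :
  Sylv a b m n = (\prod_i \prod_j (a i - b j))%:P * rootpoly a * rootpoly b.
Proof.
have full k (A : {set 'I_k}) : (#|A| == k) = (A == setT).
  rewrite eqEcard subsetT cardsT card_ord eqn_leq.
  by have := max_card A; rewrite card_ord => ->.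
rewrite /Sylv (big_pred1 setT) => [|A]; last exact: full.
rewrite (big_pred1 setT) => [|B]; last exact: full.
rewrite setCT setCT /Rprod /RprodX !big_set0 mulr1.
under [X in _ / (X * _)]eq_bigr do rewrite big_set0.
under [X in _ / (_ * X)]eq_bigr do rewrite big_set0.
rewrite !big1_eq mulr1 divr1 -mul_polyC -mulrA; congr (_%:P * (_ * _)).
- by apply: eq_big => [i|i _]; rewrite ?inE //; apply: eq_bigl => j; rewrite inE.
- by apply: eq_bigl => i; rewrite inE.
- by apply: eq_bigl => i; rewrite inE.
Qed.

(** This makes V(A) and V(B) nonzero, so that the double sums can be recovered from the
    coefficients of the generating determinant. *)
Lemma tofracX_inj k : injective (fun i : 'I_k => tofrac ('X_i : {mpoly rat[k]})).
Proof.
move=> i j /eqP; rewrite tofrac_eq => /eqP /(congr1 (mcoeff U_(i))).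
rewrite !mcoeffX eqxx; case: eqP => // /(congr1 (fun mm : 'X_{1..k} => mm i)).
by rewrite !mnm1E eqxx; case: eqP.
Qed.

Theorem mainTheorem1 (m n p q : nat)
    (hm : (1 <= m)%N) (hmn : (m <= n)%N) (hp : (p <= m)%N) (hq : (q <= n)%N) :
  let a : 'I_m -> ratfun m n := @alpha m n in
  let b : 'I_n -> ratfun m n := @beta m n in
  let f : {poly ratfun m n} := \prod_(i < m) ('X - (a i)%:P) in
  let g : {poly ratfun m n} := \prod_(j < n) ('X - (b j)%:P) in
  let res : ratfun m n := \prod_(i < m) \prod_(j < n) (a i - b j) in
  let d := (p + q)%N in
  let k := (m + n - d - 1)%N in
  let sigma := (q * (m - p) + n * (d - m) + (d + n - q - 1))%N in
  [/\ (d < m)%N \/ (m = d /\ (d < n)%N) ->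
        Sylv a b p q
        = (-1) ^+ (p * (m - d)) * 'C(d, p)%:R * Sres m n d f g,
      (m < d)%N -> (d < n - 1)%N ->
        Sylv a b p q = 0,
      (m < d)%N -> d = (n - 1)%N ->
        Sylv a b p q
        = (-1) ^+ ((m + q) * (p + 1)) * 'C(m, p)%:R * f,
      (n <= d)%N -> (d <= m + n - 1)%N ->
        Sylv a b p q
        = (-1) ^+ sigma * ('C(k, m - p)%:R * SresF m n k f g * f
                           - 'C(k, n - q)%:R * SresG m n k f g * g)
    & d = (m + n)%N ->
        Sylv a b p q = res%:P * f * g].
Proof.
have a_inj : injective (@alpha m n).
  by move=> i j; rewrite /alpha => /tofracX_inj /lshift_inj.
have b_inj : injective (@beta m n).
  by move=> i j; rewrite /beta => /tofracX_inj /rshift_inj.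
move=> a b f g res d k sigma; split.
- by move=> hd; apply: Sylv_low => //; rewrite -/d; lia.
- exact: Sylv_zero.
- exact: Sylv_middle.
- exact: Sylv_high.
move=> hd; have [-> ->] : p = m /\ q = n by rewrite /d in hd; lia.
exact: Sylv_full.
Qed.
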